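(* Let $D_1\subset\mathbb{R}^2$ be an open disc centered at the origin, let $\boldsymbol{\gamma}_1,\dots,\boldsymbol{\gamma}_m$ be distinct unit vectors in $\mathbb{R}^2$ and $c_1,\dots,c_m$ nonzero reals. The vector-valued star transform $\mathcal{S}$ (acting on vector fields on $\mathbb{R}^2$ with components in $C^2_c(D_1)$) is invertible if and only if it is not symmetric.
   Context: For $\mathbf{x}=(x_1,x_2)$ set $\mathbf{x}^\perp=(-x_2,x_1)$. For a unit vector $\boldsymbol{\gamma}$, $\mathcal{X}_{\boldsymbol{\gamma}}h(\mathbf{x})=\int_0^\infty h(\mathbf{x}+t\boldsymbol{\gamma})\,dt$. The vector-valued star transform is $\mathcal{S}\mathbf{f}=\sum_{i=1}^m c_i\,\mathcal{X}_{\boldsymbol{\gamma}_i}\begin{bmatrix}\mathbf{f}\cdot\boldsymbol{\gamma}_i\\ \mathbf{f}\cdot\boldsymbol{\gamma}_i^\perp\end{bmatrix}$. Invertible means that every such $\mathbf{f}$ is uniquely determined by $\mathcal{S}\mathbf{f}$. $\mathcal{S}$ is called symmetric if $m=2k$ for some $k\in\mathbb{N}$ and, after possible re-indexing, $\boldsymbol{\gamma}_i=-\boldsymbol{\gamma}_{k+i}$ and $c_i=-c_{k+i}$ for all $i=1,\dots,k$. *)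

(* Defs.v *)
From Stdlib Require Import Reals Lra List.
From Coquelicot Require Import Coquelicot.
Open Scope R_scope.

Definition pt := (R * R)%type.

Definition d1 (h : pt -> R) : pt -> R :=
  fun p => Derive (fun t => h (t, snd p)) (fst p).
Definition d2 (h : pt -> R) : pt -> R :=
  fun p => Derive (fun t => h (fst p, t)) (snd p).

Definition has_partials (h : pt -> R) : Prop :=
  forall p : pt, ex_derive (fun t => h (t, snd p)) (fst p) /\
                 ex_derive (fun t => h (fst p, t)) (snd p).

Definition cont2 (h : pt -> R) : Prop := forall p : pt, continuous h p.

Definition C2 (h : pt -> R) : Prop :=
  has_partials h /\ has_partials (d1 h) /\ has_partials (d2 h) /\
  cont2 h /\ cont2 (d1 h) /\ cont2 (d2 h) /\
  cont2 (d1 (d1 h)) /\ cont2 (d2 (d1 h)) /\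
  cont2 (d1 (d2 h)) /\ cont2 (d2 (d2 h)).

Definition compact_support_in_disc (r : R) (h : pt -> R) : Prop :=
  exists r', 0 <= r' < r /\
    forall p : pt, fst p ^ 2 + snd p ^ 2 > r' ^ 2 -> h p = 0.

Definition C2c (r : R) (h : pt -> R) : Prop := C2 h /\ compact_support_in_disc r h.

Definition admissible (r : R) (f : pt -> pt) : Prop :=
  C2c r (fun p => fst (f p)) /\ C2c r (fun p => snd (f p)).

Definition perp (x : pt) : pt := (- snd x, fst x).
Definition dot (x y : pt) : R := fst x * fst y + snd x * snd y.
Definition unit_vec (g : pt) : Prop := fst g ^ 2 + snd g ^ 2 = 1.

Definition Xray (g : pt) (h : pt -> R) (x : pt) : R :=
  RInt_gen (fun t => h (fst x + t * fst g, snd x + t * snd g))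
           (at_point 0) (Rbar_locally p_infty).

Definition sumR (m : nat) (a : nat -> R) : R :=
  fold_right Rplus 0 (map a (seq 0 m)).

Definition star (m : nat) (c : nat -> R) (gam : nat -> pt) (f : pt -> pt) (x : pt) : pt :=
  ( sumR m (fun i => c i * Xray (gam i) (fun p => dot (f p) (gam i)) x),
    sumR m (fun i => c i * Xray (gam i) (fun p => dot (f p) (perp (gam i))) x) ).

Definition invertible (r : R) (m : nat) (c : nat -> R) (gam : nat -> pt) : Prop :=
  forall f g : pt -> pt, admissible r f -> admissible r g ->
    star m c gam f = star m c gam g -> f = g.

Definition opp_pt (x : pt) : pt := (- fst x, - snd x).

Definition symmetric (m : nat) (c : nat -> R) (gam : nat -> pt) : Prop :=
  exists k : nat, m = (2 * k)%nat /\
  exists sigma : nat -> nat,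
    (forall i, (i < m)%nat -> (sigma i < m)%nat) /\
    (forall i j, (i < m)%nat -> (j < m)%nat -> sigma i = sigma j -> i = j) /\
    (forall i, (i < k)%nat ->
       gam (sigma i) = opp_pt (gam (sigma (k + i)%nat)) /\
       c (sigma i) = - c (sigma (k + i)%nat)).

(* Main.v *)
Require Import Defs.
From Stdlib Require Import Reals Lra Lia List Permutation Classical ClassicalEpsilon FunctionalExtensionality.
From Coquelicot Require Import Coquelicot.
Open Scope R_scope.

(** Identify the plane with the complex numbers, so that the transform of F is the scalar star
    transform with weights c_i conj(gamma_i).  The difference of X_gamma h along gamma is minus the
    integral of h over a short segment, hence compactly supported; applying all m difference
    operators to S F = 0 and taking two-sided Laplace transforms with real frequency lambda gives,
    as the step tends to 0, (sum_i c_i conj(gamma_i) / (gamma_i . lambda)) F^(lambda) = 0.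
    If some gamma_0 is not cancelled by an opposite ray, the bracket blows up as lambda approaches
    the line orthogonal to gamma_0, so F^ vanishes on an open cone; testing F against powers of
    an exponential polynomial with frequencies in this cone and a peak at a given point gives F = 0.
    If S is symmetric, only integrals over full lines enter, and these vanish on the field (h, 0)
    where h is a bump to which a finite difference along every gamma_i has been applied. *)

(** The transform of a beam X_gamma h extends to infinity along -gamma, where the kernel exp(lambda
    . p) decays only if gamma . lambda > 0. When the numbers gamma_i . lambda have both signs, the
    sum cannot be Laplace transformed term by term. The transform of a differenced term divided by
    exp(-s gamma_i . lambda) - 1 takes the place of the missing value, and finite additivity of
    these quotients suffices.

    Along lambda = gamma_0^perp + e gamma_0 the beams in directions gamma_0 and -gamma_0 both become
    singular. In the component along gamma_0 the sign of the direction cancels, so each contributes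
    its weight over e. The singular part is the sum of the two weights over e, and it disappears
    exactly for the opposite pairs in the definition of symmetry.

    Real frequencies keep everything within iterated real integrals. The cone is closed under
    addition, so products of its exponentials keep their frequencies in it; positivity and a peak
    then replace analytic continuation and Fourier inversion. *)

Lemma continuous_eps (f : R -> R) (x : R) :
  (forall eps, 0 < eps -> exists delta, 0 < delta /\
     forall y, Rabs (y - x) < delta -> Rabs (f y - f x) < eps) ->
  continuous f x.
Proof.
  intros H. apply filterlim_locally. intros eps.
  destruct (H eps (cond_pos eps)) as [d [Hd Hf]].
  exists (mkposreal d Hd). intros y Hy. apply Hf, Hy.
Qed.

Lemma continuous_pt_eps (h : pt -> R) (p : pt) :
  (forall eps, 0 < eps -> exists delta, 0 < delta /\
     forall q : pt, Rabs (fst q - fst p) < delta -> Rabs (snd q - snd p) < delta ->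
       Rabs (h q - h p) < eps) ->
  continuous h p.
Proof.
  intros H. apply filterlim_locally. intros eps.
  destruct (H eps (cond_pos eps)) as [d [Hd Hf]].
  exists (mkposreal d Hd). intros y [Hy1 Hy2]. apply Hf; assumption.
Qed.

Lemma continuous_pair {U : UniformSpace} (f g : U -> R) (x : U) :
  continuous f x -> continuous g x ->
  continuous (fun u => (f u, g u) : R * R) x.
Proof.
  intros Hf Hg.
  apply (continuous_comp_2 f g (fun a b => (a, b) : R * R)); try assumption.
  apply continuous_ext with (2 := continuous_id (f x, g x)). now intros [a b].
Qed.

Lemma continuous_affine (a b t : R) : continuous (fun t => a + t * b) t.
Proof.
  apply (continuous_plus (fun _ => a) (fun t => t * b)).
  - apply continuous_const.
  - apply (continuous_mult (fun t => t) (fun _ => b)).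
    + apply continuous_id.
    + apply continuous_const.
Qed.

(* [ring] looks for its ring structure on the type of the left-hand side, which for
   [RInt] is the carrier of a Coquelicot structure. *)
Ltac ringR := apply Rminus_diag_uniq; ring.

(** * Integrals of continuous functions on the line *)

Definition continuous_all (f : R -> R) : Prop := forall t, continuous f t.

Lemma ex_RInt_all (f : R -> R) (a b : R) : continuous_all f -> ex_RInt f a b.
Proof. intros H. apply (ex_RInt_continuous (V := R_CompleteNormedModule)). intros; apply H. Qed.

Lemma RInt_Rplus (f g : R -> R) (a b : R) : continuous_all f -> continuous_all g ->
  RInt (fun t => f t + g t) a b = RInt f a b + RInt g a b.
Proof.
  intros Hf Hg. apply (RInt_plus (V := R_CompleteNormedModule) f g); now apply ex_RInt_all.
Qed.

Lemma RInt_Rmult (f : R -> R) (k a b : R) : continuous_all f ->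
  RInt (fun t => k * f t) a b = k * RInt f a b.
Proof.
  intros Hf. apply (RInt_scal (V := R_CompleteNormedModule) f); now apply ex_RInt_all.
Qed.

Lemma RInt_Rminus (f g : R -> R) (a b : R) : continuous_all f -> continuous_all g ->
  RInt (fun t => f t - g t) a b = RInt f a b - RInt g a b.
Proof.
  intros Hf Hg. apply (RInt_minus (V := R_CompleteNormedModule) f g); now apply ex_RInt_all.
Qed.

Lemma RInt_Rsplit (f : R -> R) (a b c : R) : continuous_all f ->
  RInt f a b + RInt f b c = RInt f a c.
Proof.
  intros Hf. apply (RInt_Chasles (V := R_CompleteNormedModule) f); now apply ex_RInt_all.
Qed.

Lemma RInt_Rconst (k a b : R) : RInt (fun _ => k) a b = (b - a) * k.
Proof. apply (RInt_const (V := R_CompleteNormedModule)). Qed.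

Lemma RInt_zero (f : R -> R) (a b : R) :
  (forall t, Rmin a b < t < Rmax a b -> f t = 0) -> RInt f a b = 0.
Proof.
  intros H. rewrite (RInt_ext f (fun _ => 0)) by exact H.
  rewrite RInt_Rconst. apply Rmult_0_r.
Qed.

Lemma RInt_abs_le (f : R -> R) (a b M : R) : a <= b -> continuous_all f ->
  (forall t, a <= t <= b -> Rabs (f t) <= M) -> Rabs (RInt f a b) <= (b - a) * M.
Proof. intros Hab Hf HM. apply abs_RInt_le_const; auto. now apply ex_RInt_all. Qed.

Lemma RInt_translate (f : R -> R) (v a b : R) : continuous_all f ->
  RInt (fun t => f (t + v)) a b = RInt f (a + v) (b + v).
Proof.
  intros Hf.
  generalize (RInt_comp_lin (V := R_CompleteNormedModule) f 1 v a b (ex_RInt_all _ _ _ Hf)).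
  rewrite !Rmult_1_l. intros <-. apply RInt_ext. intros t _.
  unfold scal; simpl; unfold mult; simpl. now rewrite !Rmult_1_l.
Qed.

Lemma RInt_reflect (f : R -> R) (v a b : R) : continuous_all f ->
  RInt (fun t => f (v - t)) a b = RInt f (v - b) (v - a).
Proof.
  intros Hf.
  generalize (RInt_comp_lin (V := R_CompleteNormedModule) f (-1) v a b (ex_RInt_all _ _ _ Hf)).
  replace (-1 * a + v) with (v - a) by ring. replace (-1 * b + v) with (v - b) by ring.
  intros H.
  assert (Hg : continuous_all (fun t => f (v - t))).
  { intros t. apply (continuous_comp (fun t => v - t) f); [|apply Hf].
    apply continuous_ext with (2 := continuous_affine v (-1) t). intros; simpl; ring. }
  assert (Hs : RInt f (v - b) (v - a) = - RInt f (v - a) (v - b)).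
  { symmetry. apply (opp_RInt_swap (V := R_CompleteNormedModule)). now apply ex_RInt_all. }
  rewrite Hs, <- H.
  rewrite (RInt_ext (fun y => scal (-1) (f (-1 * y + v))) (fun t => (-1) * f (v - t))).
  - rewrite (RInt_Rmult (fun t => f (v - t)) (-1) a b Hg). ringR.
  - intros t _. replace (-1 * t + v) with (v - t) by ring. reflexivity.
Qed.

(** The interval overshoots the support by at least |v| on either side, so the two end pieces by
    which the shifted interval differs lie where f vanishes. *)
Lemma RInt_translate_supp (f : R -> R) (v rho B : R) : continuous_all f ->
  (forall t, rho < Rabs t -> f t = 0) -> rho + Rabs v <= B ->
  RInt (fun t => f (t + v)) (- B) B = RInt f (- B) B.
Proof.
  intros Hf Hs HB. rewrite RInt_translate by exact Hf.
  rewrite <- (RInt_Rsplit f (- B + v) (- B)) by exact Hf.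
  rewrite <- (RInt_Rsplit f (- B) B (B + v)) by exact Hf.
  rewrite (RInt_zero f (- B + v)), (RInt_zero f B).
  - ringR.
  - intros t Ht. apply Hs. revert Ht HB. unfold Rmin, Rmax, Rabs.
    repeat destruct Rle_dec; repeat destruct Rcase_abs; intros; lra.
  - intros t Ht. apply Hs. revert Ht HB. unfold Rmin, Rmax, Rabs.
    repeat destruct Rle_dec; repeat destruct Rcase_abs; intros; lra.
Qed.

(** * Continuous functions supported in a square *)

Definition ray (p g : pt) (t : R) : pt := (fst p + t * fst g, snd p + t * snd g).
Definition trans (g : pt) (s : R) (h : pt -> R) : pt -> R := fun p => h (ray p g s).
Definition diff (g : pt) (s : R) (h : pt -> R) : pt -> R := fun p => trans g s h p - h p.

(** A square rather than a disc, because the plane integrals are iterated: the vanishing can then be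
    used in one coordinate at a time. *)
Definition supp (rho : R) (h : pt -> R) : Prop :=
  forall p : pt, rho < Rabs (fst p) \/ rho < Rabs (snd p) -> h p = 0.
Definition nice (rho : R) (h : pt -> R) : Prop := cont2 h /\ supp rho h.

Lemma cont2_plus (h k : pt -> R) : cont2 h -> cont2 k -> cont2 (fun p => h p + k p).
Proof. intros Hh Hk p. now apply (continuous_plus h k). Qed.

Lemma cont2_minus (h k : pt -> R) : cont2 h -> cont2 k -> cont2 (fun p => h p - k p).
Proof. intros Hh Hk p. now apply (continuous_minus h k). Qed.

Lemma cont2_mult (h k : pt -> R) : cont2 h -> cont2 k -> cont2 (fun p => h p * k p).
Proof. intros Hh Hk p. now apply (continuous_mult h k). Qed.

Lemma cont2_const (a : R) : cont2 (fun _ => a).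
Proof. intros p. apply continuous_const. Qed.

Lemma cont2_fst (f : R -> R) : continuous_all f -> cont2 (fun p => f (fst p)).
Proof. intros Hf [x y]. apply (continuous_comp fst f); [apply continuous_fst | apply Hf]. Qed.

Lemma cont2_snd (f : R -> R) : continuous_all f -> cont2 (fun p => f (snd p)).
Proof. intros Hf [x y]. apply (continuous_comp snd f); [apply continuous_snd | apply Hf]. Qed.

Lemma cont2_comp (f : R -> R) (h : pt -> R) :
  continuous_all f -> cont2 h -> cont2 (fun p => f (h p)).
Proof. intros Hf Hh p. apply (continuous_comp h f); [apply Hh | apply Hf]. Qed.

Lemma cont2_trans (g : pt) (s : R) (h : pt -> R) : cont2 h -> cont2 (trans g s h).
Proof.
  intros Hh p. apply (continuous_comp (fun p => ray p g s) h); [|apply Hh].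
  apply continuous_pair.
  - apply (cont2_plus (fun p => fst p) (fun _ => s * fst g)).
    + apply (cont2_fst (fun t => t)). intros t. apply continuous_id.
    + apply cont2_const.
  - apply (cont2_plus (fun p => snd p) (fun _ => s * snd g)).
    + apply (cont2_snd (fun t => t)). intros t. apply continuous_id.
    + apply cont2_const.
Qed.

Lemma continuous_ray (g p : pt) (h : pt -> R) :
  cont2 h -> continuous_all (fun t => h (ray p g t)).
Proof.
  intros Hh t. apply (continuous_comp (ray p g) h); [|apply Hh].
  apply continuous_pair; apply continuous_affine.
Qed.

Lemma continuous_section2 (h : pt -> R) (x : R) : cont2 h -> continuous_all (fun y => h (x, y)).
Proof.
  intros Hh t. apply (continuous_comp (fun y => (x, y)) h); [|apply Hh].
  apply (continuous_pair (U := R_UniformSpace)).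
  apply continuous_const. apply continuous_id.
Qed.

Lemma nice_plus (rho : R) (h k : pt -> R) :
  nice rho h -> nice rho k -> nice rho (fun p => h p + k p).
Proof.
  intros [Hh Sh] [Hk Sk]. split; [now apply cont2_plus|].
  intros p Hp. rewrite (Sh p Hp), (Sk p Hp). ring.
Qed.

Lemma nice_minus (rho : R) (h k : pt -> R) :
  nice rho h -> nice rho k -> nice rho (fun p => h p - k p).
Proof.
  intros [Hh Sh] [Hk Sk]. split; [now apply cont2_minus|].
  intros p Hp. rewrite (Sh p Hp), (Sk p Hp). ring.
Qed.

Lemma nice_mult (rho : R) (h k : pt -> R) :
  nice rho h -> cont2 k -> nice rho (fun p => h p * k p).
Proof.
  intros [Hh Sh] Hk. split; [now apply cont2_mult|].
  intros p Hp. rewrite (Sh p Hp). ring.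
Qed.

Lemma nice_scal (rho a : R) (h : pt -> R) : nice rho h -> nice rho (fun p => a * h p).
Proof.
  intros [Hh Sh]. split; [apply cont2_mult; [apply cont2_const | exact Hh]|].
  intros p Hp. rewrite (Sh p Hp). ring.
Qed.

Lemma nice_weaken (rho rho' : R) (h : pt -> R) : rho <= rho' -> nice rho h -> nice rho' h.
Proof. intros Hr [Hh Sh]. split; [exact Hh|]. intros p Hp. apply Sh. lra. Qed.

Lemma unit_vec_abs (g : pt) : unit_vec g -> Rabs (fst g) <= 1 /\ Rabs (snd g) <= 1.
Proof. unfold unit_vec. intros H. split; apply Rabs_le; nra. Qed.

Lemma Rabs_ray_ge (x t d : R) : Rabs d <= 1 -> Rabs x <= Rabs (x + t * d) + Rabs t.
Proof.
  intros Hd.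
  assert (Ht : Rabs (t * d) <= Rabs t).
  { rewrite Rabs_mult. pose proof (Rabs_pos t). nra. }
  replace x with ((x + t * d) - t * d) at 1 by ring.
  eapply Rle_trans; [apply Rabs_triang|]. rewrite Rabs_Ropp. lra.
Qed.

Lemma supp_ray (rho s : R) (g : pt) (h : pt -> R) : unit_vec g -> supp rho h ->
  forall p t, Rabs t <= s ->
    rho + s < Rabs (fst p) \/ rho + s < Rabs (snd p) -> h (ray p g t) = 0.
Proof.
  intros Hg Hs p t Ht Hp. destruct (unit_vec_abs g Hg) as [H1 H2]. apply Hs.
  pose proof (Rabs_ray_ge (fst p) t _ H1). pose proof (Rabs_ray_ge (snd p) t _ H2).
  unfold ray; simpl. lra.
Qed.

Lemma nice_trans (rho s : R) (g : pt) (h : pt -> R) : unit_vec g -> 0 <= s ->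
  nice rho h -> nice (rho + s) (trans g s h).
Proof.
  intros Hg Hs [Hh Sh]. split; [now apply cont2_trans|].
  intros p Hp. apply (supp_ray rho s g h Hg Sh); [|exact Hp]. rewrite Rabs_pos_eq; lra.
Qed.

Lemma nice_diff (rho s : R) (g : pt) (h : pt -> R) : unit_vec g -> 0 <= s ->
  nice rho h -> nice (rho + s) (diff g s h).
Proof.
  intros Hg Hs Hh. apply nice_minus; [now apply nice_trans|].
  apply (nice_weaken rho); [lra | exact Hh].
Qed.

(** Heine's theorem applies on the square enlarged by 1. Since delta is at most 1, a pair of points
    not contained in the enlarged square lies wholly outside the support, and both values are 0. *)
Lemma nice_uniform (rho : R) (h : pt -> R) : nice rho h ->
  forall eps, 0 < eps -> exists delta, 0 < delta /\
    forall p q : pt, Rabs (fst q - fst p) < delta -> Rabs (snd q - snd p) < delta ->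
      Rabs (h q - h p) < eps.
Proof.
  intros [Hh Sh] eps Heps.
  destruct (uniform_continuity_2d (fun x y => h (x, y)) (- rho - 1) (rho + 1) (- rho - 1) (rho + 1))
    with (eps := mkposreal eps Heps) as [d Hd].
  { intros x y _ _. apply continuity_2d_pt_filterlim.
    apply filterlim_ext with (f := h); [now intros [a b] | exact (Hh (x, y))]. }
  exists (Rmin d 1). split; [apply Rmin_glb_lt; [apply cond_pos | lra]|].
  intros [x y] [u v]; simpl. intros H1 H2.
  pose proof (Rmin_l d 1). pose proof (Rmin_r d 1).
  destruct (classic ((- rho - 1 <= x <= rho + 1 /\ - rho - 1 <= y <= rho + 1) /\
                     (- rho - 1 <= u <= rho + 1 /\ - rho - 1 <= v <= rho + 1))) as [[[? ?] [? ?]]|Hout].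
  - apply (Hd x y u v); auto; lra.
  - assert (Hx : rho < Rabs x \/ rho < Rabs y).
    { apply NNPP. intros Hn. apply Hout. revert Hn H1 H2. unfold Rabs.
      repeat destruct Rcase_abs; intros; lra. }
    assert (Hu : rho < Rabs u \/ rho < Rabs v).
    { apply NNPP. intros Hn. apply Hout. revert Hn H1 H2. unfold Rabs.
      repeat destruct Rcase_abs; intros; lra. }
    rewrite (Sh (x, y) Hx), (Sh (u, v) Hu), Rminus_0_r, Rabs_R0. exact Heps.
Qed.

Lemma nice_inner (rho B : R) (h : pt -> R) : 0 <= B -> nice rho h ->
  continuous_all (fun x => RInt (fun y => h (x, y)) (- B) B).
Proof.
  intros HB Hn x. apply continuous_eps. intros eps Heps.
  assert (H2B : 0 < 2 * B + 1) by lra.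
  destruct (nice_uniform rho h Hn (eps / (2 * B + 1))) as [d [Hd Hu]].
  { now apply Rdiv_lt_0_compat. }
  exists d. split; [exact Hd|]. intros y Hy.
  destruct Hn as [Hh _].
  rewrite <- RInt_Rminus by now apply continuous_section2.
  eapply Rle_lt_trans.
  - apply (RInt_abs_le _ _ _ (eps / (2 * B + 1))); [lra| |].
    + intros t. apply (continuous_minus (fun z => h (y, z)) (fun z => h (x, z)));
        now apply continuous_section2.
    + intros t _. left. apply (Hu (x, t) (y, t)); simpl; [exact Hy|].
      rewrite Rminus_diag, Rabs_R0. exact Hd.
  - apply Rmult_lt_reg_r with (2 * B + 1); [exact H2B|].
    replace ((B - - B) * (eps / (2 * B + 1)) * (2 * B + 1)) with ((2 * B) * eps) by (field; lra).
    nra.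
Qed.

Lemma nice_bounded (rho : R) (h : pt -> R) : nice rho h ->
  exists M, 0 <= M /\ forall p, Rabs (h p) <= M.
Proof.
  intros Hn. destruct (nice_uniform rho h Hn 1 Rlt_0_1) as [d [Hd Hu]].
  (* A chain of points with steps below [d] leads from any point out of the support. *)
  set (R0 := Rabs rho + 1).
  destruct (INR_unbounded (2 * R0 / d)) as [N HN].
  assert (Hchain : forall n x y, rho < x + INR n * (d / 2) -> Rabs (h (x, y)) <= INR n).
  { induction n as [|n IH]; intros x y Hx.
    - simpl in Hx |- *. destruct Hn as [_ Sh]. rewrite (Sh (x, y)).
      + rewrite Rabs_R0. lra.
      + left. simpl. pose proof (Rle_abs x). lra.
    - rewrite S_INR in *.
      assert (H1 : Rabs (h (x + d / 2, y)) <= INR n) by (apply IH; lra).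
      assert (H2 : Rabs (h (x, y) - h (x + d / 2, y)) < 1).
      { apply Hu; simpl.
        - replace (x - (x + d / 2)) with (- (d / 2)) by ring.
          rewrite Rabs_Ropp, Rabs_pos_eq; lra.
        - rewrite Rminus_diag, Rabs_R0. exact Hd. }
      replace (h (x, y)) with ((h (x, y) - h (x + d / 2, y)) + h (x + d / 2, y)) by ring.
      eapply Rle_trans; [apply Rabs_triang|]. lra. }
  exists (INR (2 * N)). split; [apply pos_INR|].
  intros [x y]. destruct (Rlt_dec rho (Rabs x)) as [Hx|Hx].
  - destruct Hn as [_ Sh]. rewrite (Sh (x, y)) by now left. rewrite Rabs_R0. apply pos_INR.
  - apply Hchain.
    assert (HN' : 2 * R0 < INR N * d).
    { apply (Rmult_lt_compat_r d) in HN; [|exact Hd].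
      replace (2 * R0 / d * d) with (2 * R0) in HN by (field; lra). exact HN. }
    rewrite mult_INR. simpl (INR 2).
    unfold R0 in HN'. pose proof (Rle_abs rho). pose proof (Rle_abs (- x)).
    rewrite Rabs_Ropp in *. lra.
Qed.

(** * The integral over a square *)

Definition int2 (B : R) (h : pt -> R) : R :=
  RInt (fun x => RInt (fun y => h (x, y)) (- B) B) (- B) B.

Lemma int2_ext (B : R) (h k : pt -> R) : (forall p, h p = k p) -> int2 B h = int2 B k.
Proof.
  intros H. unfold int2. apply RInt_ext. intros x _. apply RInt_ext. intros y _. apply H.
Qed.

Lemma int2_plus (rho B : R) (h k : pt -> R) : 0 <= B -> nice rho h -> nice rho k ->
  int2 B (fun p => h p + k p) = int2 B h + int2 B k.
Proof.
  intros HB Hh Hk. unfold int2.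
  rewrite <- RInt_Rplus by (apply (nice_inner rho); assumption).
  apply RInt_ext. intros x _. destruct Hh as [Hh _], Hk as [Hk _].
  apply RInt_Rplus; now apply continuous_section2.
Qed.

Lemma int2_scal (rho B a : R) (h : pt -> R) : 0 <= B -> nice rho h ->
  int2 B (fun p => a * h p) = a * int2 B h.
Proof.
  intros HB Hh. unfold int2.
  rewrite <- RInt_Rmult by (apply (nice_inner rho); assumption).
  apply RInt_ext. intros x _. destruct Hh as [Hh _].
  apply (RInt_Rmult (fun y => h (x, y))); now apply continuous_section2.
Qed.

Lemma int2_abs_le (rho B M : R) (h : pt -> R) : 0 <= B -> nice rho h ->
  (forall p, Rabs (h p) <= M) -> Rabs (int2 B h) <= (2 * B) ^ 2 * M.
Proof.
  intros HB Hh HM. unfold int2.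
  replace ((2 * B) ^ 2 * M) with ((B - - B) * ((B - - B) * M)) by ring.
  apply RInt_abs_le; [lra | apply (nice_inner rho); assumption |].
  intros x _. apply RInt_abs_le; [lra | apply continuous_section2, Hh | intros; apply HM].
Qed.

Lemma int2_trans (rho B s : R) (g : pt) (h : pt -> R) : 0 <= s -> unit_vec g ->
  0 <= rho -> rho + s <= B -> nice rho h -> int2 B (trans g s h) = int2 B h.
Proof.
  intros Hs Hg Hr HB Hh. destruct (unit_vec_abs g Hg) as [H1 H2].
  assert (Habs : forall d, Rabs d <= 1 -> rho + Rabs (s * d) <= B).
  { intros d Hd. rewrite Rabs_mult, (Rabs_pos_eq s) by exact Hs. nra. }
  unfold int2.
  rewrite (RInt_ext _ (fun x => (fun x => RInt (fun y => h (x, y)) (- B) B) (x + s * fst g))).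
  - apply (RInt_translate_supp (fun x => RInt (fun y => h (x, y)) (- B) B) _ rho).
    + apply (nice_inner rho); [lra | exact Hh].
    + intros x Hx. apply RInt_zero. intros y _. apply Hh. now left.
    + now apply Habs.
  - intros x _. unfold trans, ray; simpl.
    apply (RInt_translate_supp (fun y => h (x + s * fst g, y)) _ rho).
    + apply continuous_section2, Hh.
    + intros y Hy. apply Hh. now right.
    + now apply Habs.
Qed.

(** * The two-sided Laplace transform at real frequencies, with kernel exp(lam . p) *)

Definition lap (B : R) (lam : pt) (h : pt -> R) : R := int2 B (fun p => h p * exp (dot lam p)).

Lemma cont2_dot (lam : pt) : cont2 (dot lam).
Proof.
  apply (cont2_plus (fun p => fst lam * fst p) (fun p => snd lam * snd p)).
  - apply (cont2_fst (fun t => fst lam * t)). intros t.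
    apply continuous_ext with (2 := continuous_affine 0 (fst lam) t). intros; simpl; ring.
  - apply (cont2_snd (fun t => snd lam * t)). intros t.
    apply continuous_ext with (2 := continuous_affine 0 (snd lam) t). intros; simpl; ring.
Qed.

Lemma cont2_exp (lam : pt) : cont2 (fun p => exp (dot lam p)).
Proof. apply (cont2_comp exp (dot lam)); [intros t; apply continuous_exp | apply cont2_dot]. Qed.

Lemma lap_ext (B : R) (lam : pt) (h k : pt -> R) :
  (forall p, h p = k p) -> lap B lam h = lap B lam k.
Proof. intros H. apply int2_ext. intros p. now rewrite H. Qed.

Lemma lap_plus (rho B : R) (lam : pt) (h k : pt -> R) : 0 <= B -> nice rho h -> nice rho k ->
  lap B lam (fun p => h p + k p) = lap B lam h + lap B lam k.
Proof.
  intros HB Hh Hk. unfold lap. rewrite <- (int2_plus rho) by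
    (try apply nice_mult; try apply cont2_exp; assumption).
  apply int2_ext. intros p. ring.
Qed.

Lemma lap_scal (rho B a : R) (lam : pt) (h : pt -> R) : 0 <= B -> nice rho h ->
  lap B lam (fun p => a * h p) = a * lap B lam h.
Proof.
  intros HB Hh. unfold lap. rewrite <- (int2_scal rho) by
    (try apply nice_mult; try apply cont2_exp; assumption).
  apply int2_ext. intros p. ring.
Qed.

Lemma lap_minus (rho B : R) (lam : pt) (h k : pt -> R) : 0 <= B -> nice rho h -> nice rho k ->
  lap B lam (fun p => h p - k p) = lap B lam h - lap B lam k.
Proof.
  intros HB Hh Hk.
  rewrite (lap_ext B lam _ (fun p => h p + (-1) * k p)) by (intros; ring).
  rewrite (lap_plus rho), (lap_scal rho) by (try apply nice_scal; assumption). ring.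
Qed.

Lemma lap_trans (rho B s : R) (lam g : pt) (h : pt -> R) : 0 <= s -> unit_vec g ->
  0 <= rho -> rho + s <= B -> nice rho h ->
  lap B lam (trans g s h) = exp (- (s * dot g lam)) * lap B lam h.
Proof.
  intros Hs Hg Hr HB Hh. unfold lap.
  assert (Hn : nice rho (fun p => h p * exp (dot lam p))) by (apply nice_mult; [exact Hh | apply cont2_exp]).
  rewrite <- (int2_trans rho B s g (fun p => h p * exp (dot lam p))) by assumption.
  rewrite <- (int2_scal (rho + s)) by (try apply nice_trans; try assumption; lra).
  apply int2_ext. intros p. unfold trans.
  replace (dot lam p) with (- (s * dot g lam) + dot lam (ray p g s))
    by (unfold dot, ray; simpl; ring).
  rewrite exp_plus. ring.
Qed.

Lemma lap_diff (rho B s : R) (lam g : pt) (h : pt -> R) : 0 <= s -> unit_vec g ->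
  0 <= rho -> rho + s <= B -> nice rho h ->
  lap B lam (diff g s h) = (exp (- (s * dot g lam)) - 1) * lap B lam h.
Proof.
  intros Hs Hg Hr HB Hh. unfold diff.
  rewrite (lap_minus (rho + s)) by
    (try apply nice_trans; try (apply (nice_weaken rho); [lra|]); try assumption; lra).
  rewrite (lap_trans rho) by assumption. ring.
Qed.

Lemma exp_le (x y : R) : x <= y -> exp x <= exp y.
Proof. intros [H| ->]; [left; now apply exp_increasing | apply Rle_refl]. Qed.

(** One constant serves all functions with the same support square; this is what the limit s -> 0
    requires, where the function varies with s. *)
Lemma lap_abs_le (rho B : R) (lam : pt) : 0 <= B -> exists C, 0 <= C /\
  forall h M, nice rho h -> (forall p, Rabs (h p) <= M) -> Rabs (lap B lam h) <= C * M.
Proof.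
  intros HB.
  set (E := exp ((Rabs (fst lam) + Rabs (snd lam)) * Rabs rho)).
  assert (HE : 0 < E) by apply exp_pos.
  exists ((2 * B) ^ 2 * E). split; [pose proof (pow2_ge_0 (2 * B)); nra|].
  intros h M Hh HM. rewrite Rmult_assoc.
  apply (int2_abs_le rho); [exact HB | apply nice_mult; [exact Hh | apply cont2_exp] |].
  intros p. rewrite Rabs_mult, (Rabs_pos_eq (exp _)) by (left; apply exp_pos).
  destruct (Rlt_dec rho (Rabs (fst p))) as [H1|H1].
  { destruct Hh as [_ Sh]. specialize (HM p). rewrite (Sh p (or_introl H1)), Rabs_R0 in *. nra. }
  destruct (Rlt_dec rho (Rabs (snd p))) as [H2|H2].
  { destruct Hh as [_ Sh]. specialize (HM p). rewrite (Sh p (or_intror H2)), Rabs_R0 in *. nra. }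
  assert (Hd : exp (dot lam p) <= E).
  { apply exp_le. unfold dot. pose proof (Rle_abs rho).
    pose proof (Rle_abs (fst lam * fst p)) as Ha. pose proof (Rle_abs (snd lam * snd p)) as Hb.
    rewrite Rabs_mult in Ha, Hb.
    pose proof (Rabs_pos (fst lam)). pose proof (Rabs_pos (snd lam)). nra. }
  pose proof (exp_pos (dot lam p)). pose proof (Rabs_pos (h p)). specialize (HM p). nra.
Qed.

(** * The divergent beam transform and its differences *)

Definition segint (g : pt) (s : R) (h : pt -> R) : pt -> R :=
  fun p => RInt (fun t => h (ray p g t)) 0 s.

Lemma ray_ray (p g : pt) (s t : R) : ray (ray p g s) g t = ray p g (t + s).
Proof. unfold ray; simpl. f_equal; ring. Qed.

Lemma diff_comm (g g' : pt) (s : R) (h : pt -> R) :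
  diff g s (diff g' s h) = diff g' s (diff g s h).
Proof.
  apply functional_extensionality. intros p. unfold diff, trans.
  replace (ray (ray p g s) g' s) with (ray (ray p g' s) g s)
    by (unfold ray; simpl; f_equal; ring). ring.
Qed.

(** One coordinate of a unit vector has absolute value at least 1/2. Past parameter T the ray has
    therefore left the support in that coordinate, and the improper integral is an ordinary one. *)
Lemma Xray_segint (rho T : R) (g x : pt) (h : pt -> R) : unit_vec g -> nice rho h ->
  2 * (Rabs rho + Rabs (fst x) + Rabs (snd x)) <= T -> Xray g h x = segint g T h x.
Proof.
  intros Hg [Hh Sh] HT.
  assert (Hc : continuous_all (fun t => h (ray x g t))) by now apply continuous_ray.
  assert (Hfar : forall t, T < t -> h (ray x g t) = 0).
  { intros t Ht. apply Sh. unfold ray; simpl. unfold unit_vec in Hg.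
    pose proof (Rle_abs rho). pose proof (Rabs_pos rho).
    pose proof (Rabs_pos (fst x)). pose proof (Rabs_pos (snd x)).
    assert (Hhalf : forall y d, 1 <= 2 * Rabs d -> t / 2 <= Rabs (y + t * d) + Rabs y).
    { intros y d Hd.
      assert (Htd : t / 2 <= Rabs (t * d)) by (rewrite Rabs_mult, (Rabs_pos_eq t); nra).
      replace (t * d) with ((y + t * d) - y) in Htd by ring.
      eapply Rle_trans; [exact Htd|].
      eapply Rle_trans; [apply Rabs_triang|]. rewrite Rabs_Ropp. lra. }
    assert (Hor : 1 <= 2 * Rabs (fst g) \/ 1 <= 2 * Rabs (snd g)).
    { apply NNPP. intros Hn.
      assert (Rabs (fst g) < 1 / 2) by (apply Rnot_le_lt; intros ?; apply Hn; left; lra).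
      assert (Rabs (snd g) < 1 / 2) by (apply Rnot_le_lt; intros ?; apply Hn; right; lra).
      pose proof (Rabs_pos (fst g)). pose proof (Rabs_pos (snd g)).
      rewrite <- (pow2_abs (fst g)), <- (pow2_abs (snd g)) in Hg. nra. }
    destruct Hor as [Hd|Hd]; [left|right].
    - specialize (Hhalf (fst x) _ Hd). lra.
    - specialize (Hhalf (snd x) _ Hd). lra. }
  unfold Xray. change (fun t => h (fst x + t * fst g, snd x + t * snd g)) with (fun t => h (ray x g t)).
  apply (is_RInt_gen_unique (V := R_CompleteNormedModule)).
  intros P HP. exists (fun a => a = 0) (fun b => T < b).
  - reflexivity.
  - exists T. auto.
  - intros a b -> Hb. exists (segint g T h x). split; [|now apply locally_singleton].
    simpl. replace (segint g T h x) with (RInt (fun t => h (ray x g t)) 0 b).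
    + apply (RInt_correct (V := R_CompleteNormedModule)). now apply ex_RInt_all.
    + rewrite <- (RInt_Rsplit _ 0 T b Hc). rewrite (RInt_zero _ T b).
      * apply Rplus_0_r.
      * intros t Ht. apply Hfar. rewrite Rmin_left in Ht; lra.
Qed.

Lemma Xray_lin (rho a b : R) (g x : pt) (h k : pt -> R) : unit_vec g ->
  nice rho h -> nice rho k ->
  Xray g (fun p => a * h p + b * k p) x = a * Xray g h x + b * Xray g k x.
Proof.
  intros Hg Hh Hk.
  rewrite !(Xray_segint rho _ g x _ Hg) with (2 := Rle_refl _) by
    (try apply nice_plus; try apply nice_scal; assumption).
  destruct Hh as [Hh _], Hk as [Hk _]. unfold segint.
  set (T := 2 * _).
  rewrite (RInt_Rplus (fun t => a * h (ray x g t)) (fun t => b * k (ray x g t))).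
  - rewrite !(RInt_Rmult (fun t => _ (ray x g t))) by now apply continuous_ray. reflexivity.
  - apply (continuous_ray g x (fun p => a * h p)). apply cont2_mult; [apply cont2_const | exact Hh].
  - apply (continuous_ray g x (fun p => b * k p)). apply cont2_mult; [apply cont2_const | exact Hk].
Qed.

Lemma diff_Xray (rho s : R) (g p : pt) (h : pt -> R) : unit_vec g -> 0 <= s -> nice rho h ->
  diff g s (Xray g h) p = - segint g s h p.
Proof.
  intros Hg Hs Hh. unfold diff, trans.
  set (T := 2 * (Rabs rho + Rabs (fst p) + Rabs (snd p)) +
            2 * (Rabs rho + Rabs (fst (ray p g s)) + Rabs (snd (ray p g s)))).
  assert (Hp : forall q : pt, 0 <= 2 * (Rabs rho + Rabs (fst q) + Rabs (snd q))).
  { intros q. pose proof (Rabs_pos rho). pose proof (Rabs_pos (fst q)).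
    pose proof (Rabs_pos (snd q)). lra. }
  pose proof (Hp p). pose proof (Hp (ray p g s)).
  (* Length T from the shifted point and length T + s from p end at the same place, so the two
     integrals differ exactly by the first segment. *)
  rewrite (Xray_segint rho T g (ray p g s)) by (try assumption; unfold T; lra).
  rewrite (Xray_segint rho (T + s) g p) by (try assumption; unfold T; lra).
  destruct Hh as [Hh _]. unfold segint.
  pose proof (continuous_ray g p h Hh) as Hc.
  rewrite (RInt_ext _ (fun t => (fun t => h (ray p g t)) (t + s))).
  2: { intros t _. now rewrite ray_ray. }
  rewrite (RInt_translate (fun t => h (ray p g t)) s 0 T Hc), Rplus_0_l.
  rewrite <- (RInt_Rsplit _ 0 s (T + s) Hc). ring.
Qed.

Lemma Rabs_step_lt (x t d e : R) : Rabs d <= 1 -> Rabs t < e -> Rabs (x + t * d - x) < e.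
Proof.
  intros Hd Ht. replace (x + t * d - x) with (t * d) by ring. rewrite Rabs_mult.
  pose proof (Rabs_pos t). nra.
Qed.

Lemma nice_segint (rho s : R) (g : pt) (h : pt -> R) : unit_vec g -> 0 <= s -> nice rho h ->
  nice (rho + s) (segint g s h).
Proof.
  intros Hg Hs Hh. split.
  - intros p. apply continuous_pt_eps. intros eps Heps.
    destruct (nice_uniform rho h Hh (eps / (s + 1))) as [d [Hd Hu]].
    { apply Rdiv_lt_0_compat; lra. }
    exists d. split; [exact Hd|]. intros q H1 H2. destruct Hh as [Hh _].
    unfold segint. rewrite <- RInt_Rminus by now apply continuous_ray.
    eapply Rle_lt_trans.
    + apply (RInt_abs_le _ _ _ (eps / (s + 1))); [exact Hs| |].
      * intros t. apply (continuous_minus (fun t => h (ray q g t)) (fun t => h (ray p g t)));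
          now apply continuous_ray.
      * intros t _. left. apply Hu; unfold ray; simpl.
        -- replace (_ - _) with (fst q - fst p) by ring. exact H1.
        -- replace (_ - _) with (snd q - snd p) by ring. exact H2.
    + apply Rmult_lt_reg_r with (s + 1); [lra|].
      replace ((s - 0) * (eps / (s + 1)) * (s + 1)) with (s * eps) by (field; lra). nra.
  - intros p Hp. apply RInt_zero. intros t Ht. rewrite Rmin_left, Rmax_right in Ht by lra.
    destruct Hh as [_ Sh]. apply (supp_ray rho s g h Hg Sh); [|exact Hp].
    rewrite Rabs_pos_eq; lra.
Qed.

Lemma lap_segint_small (rho B : R) (lam g : pt) (h : pt -> R) : unit_vec g -> 0 <= B ->
  nice rho h -> forall eps, 0 < eps -> exists delta, 0 < delta /\
    forall s, 0 < s < delta -> Rabs (lap B lam (segint g s h) / s - lap B lam h) < eps.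
Proof.
  intros Hg HB Hh eps Heps. destruct (unit_vec_abs g Hg) as [Hg1 Hg2].
  (* Steps s are restricted to s < 1, which puts every segment integral into the square of
     half-width rho + 1 and makes C independent of s. *)
  destruct (lap_abs_le (rho + 1) B lam HB) as [C [HC Hlap]].
  destruct (nice_uniform rho h Hh (eps / (C + 1))) as [d [Hd Hu]].
  { apply Rdiv_lt_0_compat; lra. }
  exists (Rmin d 1). split; [apply Rmin_glb_lt; lra|]. intros s [Hs0 Hs].
  pose proof (Rmin_l d 1). pose proof (Rmin_r d 1).
  assert (Hnh : nice (rho + 1) h) by (apply (nice_weaken rho); [lra | exact Hh]).
  assert (Hns : nice (rho + 1) (segint g s h)).
  { apply (nice_weaken (rho + s)); [lra|]. apply nice_segint; [exact Hg | lra | exact Hh]. }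
  replace (lap B lam (segint g s h) / s - lap B lam h)
    with (/ s * (lap B lam (segint g s h) - s * lap B lam h)) by (field; lra).
  rewrite <- (lap_scal (rho + 1)) by assumption.
  rewrite <- (lap_minus (rho + 1)) by (try apply nice_scal; assumption).
  rewrite Rabs_mult, Rabs_pos_eq by (left; now apply Rinv_0_lt_compat).
  apply Rmult_lt_reg_l with s; [exact Hs0|].
  rewrite <- Rmult_assoc, Rinv_r, Rmult_1_l by lra.
  eapply Rle_lt_trans.
  - apply (Hlap _ (s * (eps / (C + 1)))).
    + apply nice_minus; [exact Hns | now apply nice_scal].
    + intros p. destruct Hh as [Hh _].
      replace (s * h p) with (RInt (fun _ => h p) 0 s) by (rewrite RInt_Rconst; ringR).
      unfold segint. rewrite <- RInt_Rminus.
      2: now apply continuous_ray.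
      2: intros t; apply continuous_const.
      replace (s * (eps / (C + 1))) with ((s - 0) * (eps / (C + 1))) by ring.
      apply RInt_abs_le; [lra| |].
      * intros t. apply (continuous_minus (fun t => h (ray p g t)) (fun _ => h p)).
        now apply continuous_ray. apply continuous_const.
      * intros t Ht. left. apply Hu; unfold ray; simpl; apply Rabs_step_lt; try assumption;
          rewrite Rabs_pos_eq; lra.
  - replace (C * (s * (eps / (C + 1)))) with (s * (eps * (C / (C + 1)))) by (field; lra).
    apply Rmult_lt_compat_l; [exact Hs0|].
    assert (C / (C + 1) < 1).
    { apply Rmult_lt_reg_r with (C + 1); [lra|].
      replace (C / (C + 1) * (C + 1)) with C by (field; lra). lra. }
    nra.
Qed.

(** [sumR m] is convertible with [lsum (seq 0 m)]; arbitrary index lists make induction, splitting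
    and permutation available. *)
Definition lsum (l : list nat) (a : nat -> R) : R := fold_right Rplus 0 (map a l).

Lemma lsum_ext (l : list nat) (a b : nat -> R) :
  (forall i, In i l -> a i = b i) -> lsum l a = lsum l b.
Proof. intros H. unfold lsum. f_equal. now apply map_ext_in. Qed.

Lemma lsum_lin (l : list nat) (u v : R) (a b : nat -> R) :
  lsum l (fun i => u * a i + v * b i) = u * lsum l a + v * lsum l b.
Proof. unfold lsum. induction l as [|i l IH]; simpl; [|rewrite IH]; ring. Qed.

Lemma lsum_zero (l : list nat) (a : nat -> R) : (forall i, In i l -> a i = 0) -> lsum l a = 0.
Proof.
  unfold lsum. induction l as [|i l IH]; simpl; intros H; [reflexivity|].
  rewrite H, IH by auto. ring.
Qed.

Lemma lsum_lim (l : list nat) (a : nat -> nat -> R) (b : nat -> R) :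
  (forall i, In i l -> is_lim_seq (fun n => a n i) (b i)) ->
  is_lim_seq (fun n => lsum l (a n)) (lsum l b).
Proof.
  unfold lsum. induction l as [|i l IH]; simpl; intros H; [apply is_lim_seq_const|].
  apply is_lim_seq_plus'; auto.
Qed.

(* Formally [lap u] is [lap (diff u) / (exp ... - 1)] even when [u] itself is not compactly
   supported; this is the finite additivity that makes the formal definition consistent. *)
Lemma lap_sum (B s : R) (lam : pt) (gam : nat -> pt) (l : list nat) : 0 <= s ->
  (forall i, In i l -> unit_vec (gam i)) ->
  (forall i, In i l -> exp (- (s * dot (gam i) lam)) - 1 <> 0) ->
  forall (u : nat -> pt -> R) (N : pt -> R) (rho : R),
  0 <= rho -> rho + s * INR (length l) <= B ->
  (forall i, In i l -> nice rho (diff (gam i) s (u i))) -> nice rho N ->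
  (forall p, lsum l (fun i => u i p) = N p) ->
  lsum l (fun i => lap B lam (diff (gam i) s (u i)) / (exp (- (s * dot (gam i) lam)) - 1)) =
  lap B lam N.
Proof.
  intros Hs. induction l as [|i0 l IH]; intros Hunit Hexp u N rho Hrho HB Hu HN Hsum.
  - simpl in HB. rewrite Rmult_0_r in HB.
    rewrite (lap_ext B lam N (fun p => 0 * N p)).
    + rewrite (lap_scal rho) by (try assumption; lra). unfold lsum; simpl. ring.
    + intros p. rewrite <- Hsum. unfold lsum; simpl. ring.
  - assert (HINR : INR (length (i0 :: l)) = INR (length l) + 1) by (simpl length; apply S_INR).
    rewrite HINR in HB. pose proof (pos_INR (length l)).
    pose proof (Hunit i0 (or_introl eq_refl)) as Hg0.
    pose proof (Hexp i0 (or_introl eq_refl)) as He0.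
    pose proof (Hu i0 (or_introl eq_refl)) as Hn0.
    (* The head is removed by differencing the whole identity along its direction: the difference of
       [u i0] has bounded support and moves to the right-hand side, and the tail meets the
       hypotheses with radius rho + s. Each direction costs s of the margin in B. Division by the
       nonzero factor of the head then restores the claim. *)
    specialize (IH (fun i H => Hunit i (or_intror H)) (fun i H => Hexp i (or_intror H))
      (fun i => diff (gam i0) s (u i))
      (fun p => diff (gam i0) s N p - diff (gam i0) s (u i0) p) (rho + s)).
    assert (Hle : rho + s <= B) by nra.
    assert (Hcl : forall k, nice rho k ->
      lap B lam (diff (gam i0) s k) = (exp (- (s * dot (gam i0) lam)) - 1) * lap B lam k).
    { intros k Hk. now apply (lap_diff rho). }
    rewrite (lap_minus (rho + s)) in IH; [|lra|now apply nice_diff|].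
    2: { apply (nice_weaken rho); [lra | exact Hn0]. }
    rewrite (Hcl N HN) in IH.
    change (lsum (i0 :: l) ?f) with (f i0 + lsum l f). cbv beta.
    assert (Hmul : (exp (- (s * dot (gam i0) lam)) - 1) *
       lsum l (fun i => lap B lam (diff (gam i) s (u i)) / (exp (- (s * dot (gam i) lam)) - 1)) =
       (exp (- (s * dot (gam i0) lam)) - 1) * lap B lam N - lap B lam (diff (gam i0) s (u i0))).
    { rewrite <- IH.
      - rewrite <- (Rplus_0_r (_ * lsum l _)), <- (Rmult_0_l (lsum l (fun _ => 0))).
        rewrite <- lsum_lin. apply lsum_ext. intros i Hi.
        rewrite diff_comm, Hcl by (apply Hu; now right). unfold Rdiv. ring.
      - lra.
      - nra.
      - intros i Hi. rewrite diff_comm. apply nice_diff; [exact Hg0 | exact Hs | apply Hu; now right].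
      - apply nice_minus; [now apply nice_diff|]. apply (nice_weaken rho); [lra | exact Hn0].
      - intros p. unfold diff at 2 3, trans. rewrite <- !Hsum.
        change (lsum (i0 :: l) ?f) with (f i0 + lsum l f). cbv beta.
        rewrite (lsum_ext l _ (fun i => 1 * u i (ray p (gam i0) s) + (-1) * u i p))
          by (intros i _; unfold diff, trans; ring).
        rewrite lsum_lin. ring. }
    apply Rmult_eq_reg_l with (2 := He0). rewrite Rmult_plus_distr_l, Hmul. field. exact He0.
Qed.

Lemma lap_beams (rho B : R) (lam : pt) (gam : nat -> pt) (c : nat -> R) (h : nat -> pt -> R)
  (l : list nat) : 0 <= rho -> rho + 1 + INR (length l) <= B ->
  (forall i, In i l -> unit_vec (gam i)) -> (forall i, In i l -> dot (gam i) lam <> 0) ->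
  (forall i, In i l -> nice rho (h i)) ->
  (forall p, lsum l (fun i => c i * Xray (gam i) (h i) p) = 0) ->
  lsum l (fun i => c i * lap B lam (h i) / dot (gam i) lam) = 0.
Proof.
  intros Hrho HB Hunit Ha Hh Hsum.
  (* Steps of length at most 1: the lower bound on B reserves 1 for the segment integrals and at
     most 1 for each difference taken in [lap_sum]. *)
  set (s := fun n : nat => / (INR n + 1)).
  assert (Hspos : forall n, 0 < s n).
  { intros n. apply Rinv_0_lt_compat. pose proof (pos_INR n). lra. }
  assert (Hs1 : forall n, s n <= 1).
  { intros n. rewrite <- Rinv_1. apply Rinv_le_contravar; [lra|]. pose proof (pos_INR n). lra. }
  assert (Hslim : is_lim_seq s 0).
  { apply (is_lim_seq_ext (fun n => / (INR (S n)))).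
    - intros n. unfold s. now rewrite S_INR.
    - apply (is_lim_seq_incr_1 (fun n => / INR n)).
      replace (Finite 0) with (Rbar_inv p_infty) by reflexivity.
      apply is_lim_seq_inv; [apply is_lim_seq_INR | discriminate]. }
  pose proof (pos_INR (length l)).
  assert (Hdiff : forall n i, In i l -> diff (gam i) (s n) (fun p => c i * Xray (gam i) (h i) p) =
                            (fun p => - c i * segint (gam i) (s n) (h i) p)).
  { intros n i Hi. apply functional_extensionality. intros p.
    pose proof (diff_Xray rho (s n) (gam i) p (h i) (Hunit i Hi) (Rlt_le _ _ (Hspos n)) (Hh i Hi)) as Hd.
    transitivity (c i * diff (gam i) (s n) (Xray (gam i) (h i)) p).
    - unfold diff, trans. ring.
    - rewrite Hd. ring. }
  assert (Hns : forall n i, In i l -> nice (rho + 1) (segint (gam i) (s n) (h i))).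
  { intros n i Hi. apply (nice_weaken (rho + s n)); [specialize (Hs1 n); lra|].
    apply nice_segint; [now apply Hunit | left; apply Hspos | now apply Hh]. }
  set (x := fun n i => lap B lam (fun p => - c i * segint (gam i) (s n) (h i) p) /
                       (exp (- (s n * dot (gam i) lam)) - 1)).
  assert (Hx0 : forall n, lsum l (x n) = 0).
  { intros n.
    transitivity (lap B lam (fun _ => 0)).
    - rewrite <- (lap_sum B (s n) lam gam l) with (rho := rho + 1)
        (u := fun i p => c i * Xray (gam i) (h i) p).
      + apply lsum_ext. intros i Hi. now rewrite Hdiff.
      + left; apply Hspos.
      + exact Hunit.
      + intros i Hi He.
        assert (Hz : - (s n * dot (gam i) lam) = 0) by (apply exp_inv; rewrite exp_0; lra).
        specialize (Hspos n). specialize (Ha i Hi). nra.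
      + lra.
      + specialize (Hs1 n). specialize (Hspos n). nra.
      + intros i Hi. rewrite Hdiff by exact Hi. apply nice_scal. now apply Hns.
      + split; [apply cont2_const | now intros].
      + exact Hsum.
    - rewrite (lap_ext B lam _ (fun p => 0 * (fun _ => 0) p)) by (intros; ring).
      rewrite (lap_scal rho B 0 lam (fun _ => 0)); [ring | lra |].
      split; [apply cont2_const | now intros]. }
  assert (Hlim : is_lim_seq (fun n => lsum l (x n))
                   (lsum l (fun i => c i * lap B lam (h i) / dot (gam i) lam))).
  { apply lsum_lim. intros i Hi. specialize (Ha i Hi). set (a := dot (gam i) lam) in *.
    (* Numerator and denominator are both of order s; dividing them by s leaves a mean of h above
       and the difference quotient of exp at 0 below. *)
    apply (is_lim_seq_ext (fun n => (- c i * (lap B lam (segint (gam i) (s n) (h i)) / s n)) /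
        (- a * ((exp (- (s n * a)) - 1) / (- (s n * a)))))).
    { intros n. unfold x. fold a. rewrite (lap_scal (rho + 1)) by (try apply Hns; try assumption; lra).
      specialize (Hspos n).
      assert (exp (- (s n * a)) - 1 <> 0).
      { intros He. assert (- (s n * a) = 0) by (apply exp_inv; rewrite exp_0; lra). nra. }
      field. repeat split; try assumption; lra. }
    replace (c i * lap B lam (h i) / a) with ((- c i * lap B lam (h i)) / (- a * 1)) by (field; exact Ha).
    apply is_lim_seq_div'; [| |lra].
    - apply (is_lim_seq_scal_l _ (- c i) (Finite (lap B lam (h i)))).
      apply is_lim_seq_spec. intros eps.
      destruct (lap_segint_small rho B lam (gam i) (h i) (Hunit i Hi)) with (eps := eps : R)
        as [d [Hd Hsm]]; [lra | now apply Hh | apply cond_pos |].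
      apply is_lim_seq_spec in Hslim. destruct (Hslim (mkposreal d Hd)) as [n0 Hn0].
      exists n0. intros n Hn. apply Hsm. split; [apply Hspos|].
      specialize (Hn0 n Hn). simpl in Hn0. rewrite Rminus_0_r in Hn0.
      now apply Rabs_def2 in Hn0.
    - apply (is_lim_seq_scal_l _ (- a) (Finite 1)).
      apply (is_lim_comp_seq (fun y => (exp y - 1) / y) (fun n => - (s n * a)) 0 1).
      + apply is_lim_div_expm1_0.
      + exists 0%nat. intros n _ He. injection He as He. specialize (Hspos n). nra.
      + apply (is_lim_seq_ext (fun n => - a * s n)); [intros; ring|].
        replace (Finite 0) with (Rbar_mult (- a) 0) by (simpl; f_equal; ring).
        now apply is_lim_seq_scal_l. }
  apply (is_lim_seq_ext _ (fun _ => 0)) in Hlim; [|exact Hx0].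
  apply is_lim_seq_unique in Hlim. rewrite Lim_seq_const in Hlim. now injection Hlim.
Qed.

(** * Uniqueness for Laplace transforms known on a cone *)

Lemma RInt_ge_const (f : R -> R) (a b m : R) : a <= b -> continuous_all f ->
  (forall t, a <= t <= b -> m <= f t) -> (b - a) * m <= RInt f a b.
Proof.
  intros Hab Hf Hm. rewrite <- RInt_Rconst. apply RInt_le; [exact Hab| | |].
  - apply ex_RInt_all. intros t. apply continuous_const.
  - now apply ex_RInt_all.
  - intros t Ht. apply Hm. lra.
Qed.

Lemma RInt_peak (f : R -> R) (B x0 d a b : R) : continuous_all f -> 0 <= d -> 0 <= b ->
  - B <= x0 - d -> x0 + d <= B ->
  (forall t, - B <= t <= B -> - b <= f t) ->
  (forall t, x0 - d <= t <= x0 + d -> a <= f t) ->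
  2 * d * a - 2 * B * b <= RInt f (- B) B.
Proof.
  intros Hf Hd Hb H1 H2 Hlow Hpeak.
  rewrite <- (RInt_Rsplit f (- B) (x0 - d) B Hf), <- (RInt_Rsplit f (x0 - d) (x0 + d) B Hf).
  assert (I1 : (x0 - d - - B) * (- b) <= RInt f (- B) (x0 - d)).
  { apply RInt_ge_const; [lra | exact Hf | intros; apply Hlow; lra]. }
  assert (I2 : (x0 + d - (x0 - d)) * a <= RInt f (x0 - d) (x0 + d)).
  { apply RInt_ge_const; [lra | exact Hf | exact Hpeak]. }
  assert (I3 : (B - (x0 + d)) * (- b) <= RInt f (x0 + d) B).
  { apply RInt_ge_const; [lra | exact Hf | intros; apply Hlow; lra]. }
  nra.
Qed.

(** If G were positive at p0, then G K^n would be at least of order (C - eta/2)^n on a small square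
    about p0, nonnegative wherever G is close to G(p0), and at least -M (C - eta)^n elsewhere. For
    large n the peak wins, so the integral could not vanish. *)
Lemma int2_peak (rho B C : R) (p0 : pt) (G K : pt -> R) : 0 <= rho < B -> nice rho G ->
  cont2 K -> Rabs (fst p0) <= rho -> Rabs (snd p0) <= rho -> 0 < C -> K p0 = C ->
  (forall p : pt, Rabs (fst p) <= B -> Rabs (snd p) <= B -> 0 <= K p) ->
  (forall d, 0 < d -> exists eta, 0 < eta /\ forall p : pt,
     Rabs (fst p) <= B -> Rabs (snd p) <= B ->
     d <= Rabs (fst p - fst p0) \/ d <= Rabs (snd p - snd p0) -> K p <= C - eta) ->
  (forall n, int2 B (fun p => G p * K p ^ n) = 0) -> ~ 0 < G p0.
Proof.
  intros HB HG HK Hx0 Hy0 HC HKC HKpos HKout Hint HG0.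
  destruct (nice_bounded rho G HG) as [M [HM HGM]].
  destruct (nice_uniform rho G HG (G p0 / 2)) as [d [Hd HGd]]; [lra|].
  destruct (HKout d Hd) as [eta0 [Heta0 Hout]].
  (* The cap C/2 keeps the bases C - eta and C - eta/2 positive, so that their powers are
     monotone. *)
  set (eta := Rmin eta0 (C / 2)).
  assert (Heta : 0 < eta) by (apply Rmin_glb_lt; lra).
  assert (HetaC : eta <= C / 2) by apply Rmin_r.
  assert (Heta' : eta <= eta0) by apply Rmin_l.
  assert (Hcont : exists e, 0 < e /\ forall q : pt, Rabs (fst q - fst p0) < e ->
            Rabs (snd q - snd p0) < e -> C - eta / 2 <= K q).
  { assert (Hq : 0 < eta / 2) by lra.
    destruct (proj1 (filterlim_locally _ _) (HK p0) (mkposreal _ Hq)) as [e He].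
    exists e. split; [apply cond_pos|]. intros q H1 H2.
    specialize (He q (conj H1 H2)). change (Rabs (K q - K p0) < eta / 2) in He.
    apply Rabs_def2 in He. lra. }
  destruct Hcont as [e [He HKe]].
  (* Within r of p0 the lower bounds for G and for K both hold, and r <= B - rho keeps the peak
     square inside the domain of integration. *)
  set (r := Rmin (Rmin (d / 2) (e / 2)) (B - rho)).
  assert (Hr : 0 < r) by (repeat apply Rmin_glb_lt; lra).
  assert (Hrd : r <= d / 2) by (eapply Rle_trans; [apply Rmin_l | apply Rmin_l]).
  assert (Hre : r <= e / 2) by (eapply Rle_trans; [apply Rmin_l | apply Rmin_r]).
  assert (HrB : r <= B - rho) by apply Rmin_r.
  set (a := fun n => G p0 / 2 * (C - eta / 2) ^ n). set (b := fun n => M * (C - eta) ^ n).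
  assert (Hb : forall n, 0 <= b n).
  { intros n. apply Rmult_le_pos; [exact HM | apply pow_le; lra]. }
  assert (Hlow : forall n (p : pt), Rabs (fst p) <= B -> Rabs (snd p) <= B ->
            - b n <= G p * K p ^ n).
  { intros n p H1 H2. specialize (HKpos p H1 H2).
    assert (Hpw : 0 <= K p ^ n) by now apply pow_le.
    destruct (Rlt_dec (Rabs (fst p - fst p0)) d) as [D1|D1];
      [destruct (Rlt_dec (Rabs (snd p - snd p0)) d) as [D2|D2]|].
    - specialize (HGd p0 p D1 D2). apply Rabs_def2 in HGd. specialize (Hb n). nra.
    - assert (Hk : K p ^ n <= (C - eta) ^ n).
      { apply pow_incr. split; [exact HKpos|]. specialize (Hout p H1 H2). lra. }
      specialize (HGM p). apply Rabs_le_between in HGM. unfold b. nra.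
    - assert (Hk : K p ^ n <= (C - eta) ^ n).
      { apply pow_incr. split; [exact HKpos|]. specialize (Hout p H1 H2). lra. }
      specialize (HGM p). apply Rabs_le_between in HGM. unfold b. nra. }
  assert (Hpeak : forall n (p : pt), fst p0 - r <= fst p <= fst p0 + r ->
            snd p0 - r <= snd p <= snd p0 + r -> a n <= G p * K p ^ n).
  { intros n p H1 H2.
    assert (D1 : Rabs (fst p - fst p0) <= r) by (apply Rabs_le; lra).
    assert (D2 : Rabs (snd p - snd p0) <= r) by (apply Rabs_le; lra).
    assert (HGp : Rabs (G p - G p0) < G p0 / 2) by (apply HGd; lra).
    assert (HKp : C - eta / 2 <= K p) by (apply HKe; lra).
    apply Rabs_def2 in HGp.
    assert (Hk : (C - eta / 2) ^ n <= K p ^ n) by (apply pow_incr; lra).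
    assert (0 <= (C - eta / 2) ^ n) by (apply pow_le; lra).
    unfold a. nra. }
  apply Rabs_le_between in Hx0, Hy0.
  assert (Hmain : forall n, 4 * r ^ 2 * a n <= (4 * B * r + 4 * B ^ 2) * b n).
  { intros n. specialize (Hb n).
    assert (HGK : nice rho (fun p => G p * K p ^ n)).
    { apply nice_mult; [exact HG|]. apply (cont2_comp (fun t => t ^ n) K); [|exact HK].
      intros t. apply (ex_derive_continuous (V := R_NormedModule)). auto_derive. exact I. }
    assert (Hin : forall x, continuous_all (fun y => G (x, y) * K (x, y) ^ n)).
    { intros x. apply (continuous_section2 (fun p => G p * K p ^ n)), HGK. }
    assert (H0 : 2 * r * (2 * r * a n - 2 * B * b n) - 2 * B * (2 * B * b n) <=
                 int2 B (fun p => G p * K p ^ n)).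
    { apply RInt_peak with (x0 := fst p0); try lra.
      - apply (nice_inner rho B (fun p => G p * K p ^ n)); [lra | exact HGK].
      - nra.
      - intros x Hx. replace (- (2 * B * b n)) with ((B - - B) * (- b n)) by ring.
        apply RInt_ge_const; [lra | apply Hin |].
        intros y Hy. apply (Hlow n (x, y)); simpl; apply Rabs_le; lra.
      - intros x Hx. apply RInt_peak with (x0 := snd p0); try lra.
        + apply Hin.
        + intros y Hy. apply (Hlow n (x, y)); simpl; apply Rabs_le; lra.
        + intros y Hy. now apply (Hpeak n (x, y)). }
    rewrite Hint in H0. nra. }
  (* The ratio of the two bases: the geometric decay of q^n beats the fixed ratio A / D of peak to
     error constants. *)
  set (q := (C - eta) / (C - eta / 2)).
  assert (Hq : 0 <= q < 1).
  { unfold q. split; [apply Rmult_le_pos; [lra | left; apply Rinv_0_lt_compat; lra]|].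
    apply Rmult_lt_reg_r with (C - eta / 2); [lra|]. unfold Rdiv.
    rewrite Rmult_assoc, Rinv_l; lra. }
  set (A := 2 * r ^ 2 * G p0). set (D := (4 * B * r + 4 * B ^ 2) * M + 1).
  assert (HA : 0 < A) by (unfold A; pose proof (pow_lt r 2 Hr); nra).
  assert (HD : 0 < D).
  { unfold D. assert (0 <= 4 * B * r + 4 * B ^ 2) by nra. nra. }
  destruct (pow_lt_1_zero q) with (y := A / D) as [N HN].
  { rewrite Rabs_pos_eq; lra. }
  { now apply Rdiv_lt_0_compat. }
  specialize (HN N (le_n N)). rewrite Rabs_pos_eq in HN by (apply pow_le; lra).
  specialize (Hmain N). unfold a, b in Hmain.
  assert (Hpw : 0 < (C - eta / 2) ^ N) by (apply pow_lt; lra).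
  replace ((C - eta) ^ N) with (q ^ N * (C - eta / 2) ^ N) in Hmain.
  2: { rewrite <- Rpow_mult_distr. f_equal. unfold q. field. lra. }
  assert (Hq' : q ^ N * D < A).
  { apply (Rmult_lt_compat_r D) in HN; [|exact HD].
    replace (A / D * D) with A in HN by (field; lra). exact HN. }
  assert (Hqn : 0 <= q ^ N) by (apply pow_le; lra).
  assert (A * (C - eta / 2) ^ N <= (q ^ N * D) * (C - eta / 2) ^ N).
  { unfold A, D. nra. }
  nra.
Qed.

Definition addpt (x y : pt) : pt := (fst x + fst y, snd x + snd y).

Definition annihilated (B rho : R) (P : pt -> Prop) (h : pt -> R) : Prop :=
  nice rho h /\ forall lam, P lam -> lap B lam h = 0.

Lemma annihilated_lin (B rho a b : R) (P : pt -> Prop) (h k : pt -> R) : 0 <= B ->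
  annihilated B rho P h -> annihilated B rho P k ->
  annihilated B rho P (fun p => a * h p + b * k p).
Proof.
  intros HB [Hh Zh] [Hk Zk]. split; [apply nice_plus; now apply nice_scal|].
  intros lam Hl. rewrite (lap_plus rho), !(lap_scal rho) by (try apply nice_scal; assumption).
  rewrite Zh, Zk by exact Hl. ring.
Qed.

(** Multiplication by exp(mu . p) translates the frequency by mu, and P is stable under this
    translation. *)
Lemma annihilated_exp (B rho a b : R) (P : pt -> Prop) (mu : pt) (h : pt -> R) : 0 <= B ->
  (forall lam, P lam -> P (addpt lam mu)) -> annihilated B rho P h ->
  annihilated B rho P (fun p => (a * exp (dot mu p) + b) * h p).
Proof.
  intros HB HP Hh.
  replace (fun p => (a * exp (dot mu p) + b) * h p)
    with (fun p => a * (h p * exp (dot mu p)) + b * h p)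
    by (apply functional_extensionality; intros; ring).
  apply (annihilated_lin B rho a b P (fun p => h p * exp (dot mu p)) h); [exact HB| |exact Hh].
  destruct Hh as [Hh Zh]. split; [apply nice_mult; [exact Hh | apply cont2_exp]|].
  intros lam Hl. rewrite <- (Zh (addpt lam mu)) by now apply HP.
  apply int2_ext. intros p. rewrite Rmult_assoc, <- exp_plus. do 2 f_equal.
  unfold dot, addpt; simpl. ring.
Qed.

(** The base is a combination of squares of affine functions of exponentials, so each further power
    comes from applying [annihilated_exp] twice per square, without expanding anything. *)
Lemma annihilated_pow (B rho C a b : R) (P : pt -> Prop) (mu nu : pt) (h : pt -> R) : 0 <= B ->
  (forall lam, P lam -> P (addpt lam mu)) -> (forall lam, P lam -> P (addpt lam nu)) ->
  annihilated B rho P h -> forall n,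
  annihilated B rho P (fun p => h p *
    (C - (a * exp (dot mu p) - 1) ^ 2 - (b * exp (dot nu p) - 1) ^ 2) ^ n).
Proof.
  intros HB Hmu Hnu Hh. induction n as [|n IH].
  - replace (fun p => _) with h; [exact Hh|].
    apply functional_extensionality; intros; simpl; ring.
  - set (k := fun p => h p * _ ^ n) in IH.
    pose proof (annihilated_exp B rho a (-1) P mu _ HB Hmu (annihilated_exp B rho a (-1) P mu _ HB Hmu IH)) as H1.
    pose proof (annihilated_exp B rho b (-1) P nu _ HB Hnu (annihilated_exp B rho b (-1) P nu _ HB Hnu IH)) as H2.
    pose proof (annihilated_lin B rho C (-1) P _ _ HB IH
      (annihilated_lin B rho 1 1 P _ _ HB H1 H2)) as H3.
    replace (fun p => _) with (fun p : pt => C * k p +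
      (-1) * (1 * ((a * exp (dot mu p) + -1) * ((a * exp (dot mu p) + -1) * k p)) +
              1 * ((b * exp (dot nu p) + -1) * ((b * exp (dot nu p) + -1) * k p)))).
    + exact H3.
    + apply functional_extensionality; intros p. unfold k. simpl. ring.
Qed.

(** For t >= 0 this is exp t - 1 >= t; for t < 0 the bound exp t <= 1 / (1 - t) gives 1 - exp t >=
    |t| / (1 + |t|). It turns distance from the peak into a definite loss. *)
Lemma exp_minus_1_sqr_ge (t T : R) : Rabs t <= T -> (t / (1 + T)) ^ 2 <= (exp t - 1) ^ 2.
Proof.
  intros HT. pose proof (Rabs_pos t).
  assert (H1 : Rabs (t / (1 + T)) <= Rabs (exp t - 1)).
  { unfold Rdiv. rewrite Rabs_mult, (Rabs_pos_eq (/ (1 + T))) by (left; apply Rinv_0_lt_compat; lra).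
    apply Rmult_le_reg_r with (1 + T); [lra|]. rewrite Rmult_assoc, Rinv_l, Rmult_1_r by lra.
    destruct (Rle_dec 0 t) as [Ht|Ht].
    - pose proof (exp_ineq1_le t). rewrite (Rabs_pos_eq t), (Rabs_pos_eq (exp t - 1)) by lra. nra.
    - rewrite (Rabs_left t) in * by lra.
      pose proof (exp_ineq1_le (- t)) as He. pose proof (exp_pos t).
      assert (exp t * exp (- t) = 1) by (rewrite <- exp_plus, Rplus_opp_r; apply exp_0).
      assert (exp t * (1 - t) <= 1) by nra.
      rewrite Rabs_left1 by nra. nra. }
  rewrite <- (pow2_abs (t / _)), <- (pow2_abs (exp t - 1)).
  apply pow_incr. split; [apply Rabs_pos | exact H1].
Qed.

Lemma exp_minus_1_sqr_le (t T : R) : Rabs t <= T -> (exp t - 1) ^ 2 <= exp T ^ 2.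
Proof.
  intros HT. pose proof (Rabs_pos t). pose proof (Rle_abs t).
  assert (exp t <= exp T) by (apply exp_le; lra).
  assert (1 <= exp T) by (rewrite <- exp_0; apply exp_le; lra).
  pose proof (exp_pos t). nra.
Qed.

(** The peak function is K(p) = C - (exp(mu . (p - p0)) - 1)^2 - (exp(nu . (p - p0)) - 1)^2. It is
    an exponential polynomial with frequencies generated by mu and nu, and independence of mu and nu
    makes p0 its only maximum. *)
Lemma lap_cone_unique (B rho : R) (P : pt -> Prop) (F : pt -> R) (l0 mu nu : pt) :
  0 <= rho < B -> P l0 -> fst mu * snd nu - snd mu * fst nu <> 0 ->
  (forall lam, P lam -> P (addpt lam mu)) -> (forall lam, P lam -> P (addpt lam nu)) ->
  annihilated B rho P F -> forall p, F p = 0.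
Proof.
  intros HB Hl0 Hdet Hmu Hnu HF p0. apply NNPP. intros HFp.
  assert (HB0 : 0 <= B) by lra.
  assert (Hsq : Rabs (fst p0) <= rho /\ Rabs (snd p0) <= rho).
  { destruct HF as [[_ Sh] _]. split; apply Rnot_lt_le; intros H; apply HFp, Sh; auto. }
  set (D := Rabs (fst mu) + Rabs (snd mu) + Rabs (fst nu) + Rabs (snd nu)).
  (* T bounds both exponents on the square of integration; each subtracted square is then at most
     (exp T)^2, so this C gives K >= 1 there. *)
  set (T := D * (2 * B)). set (C := 2 * exp T ^ 2 + 1).
  set (K := fun p => C - (exp (- dot mu p0) * exp (dot mu p) - 1) ^ 2 -
                         (exp (- dot nu p0) * exp (dot nu p) - 1) ^ 2).
  assert (HK : forall p, K p = C - (exp (dot mu p - dot mu p0) - 1) ^ 2 -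
                                   (exp (dot nu p - dot nu p0) - 1) ^ 2).
  { intros p. unfold K. rewrite <- !exp_plus.
    now rewrite (Rplus_comm _ (dot mu p)), (Rplus_comm _ (dot nu p)). }
  pose proof (Rabs_pos (fst mu)) as Am1. pose proof (Rabs_pos (snd mu)) as Am2.
  pose proof (Rabs_pos (fst nu)) as An1. pose proof (Rabs_pos (snd nu)) as An2.
  assert (HT : forall p : pt, Rabs (fst p) <= B -> Rabs (snd p) <= B ->
    Rabs (dot mu p - dot mu p0) <= T /\ Rabs (dot nu p - dot nu p0) <= T).
  { intros p H1 H2. destruct Hsq as [Q1 Q2].
    assert (D1 : Rabs (fst p - fst p0) <= 2 * B).
    { unfold Rminus. eapply Rle_trans; [apply Rabs_triang|]. rewrite Rabs_Ropp. lra. }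
    assert (D2 : Rabs (snd p - snd p0) <= 2 * B).
    { unfold Rminus. eapply Rle_trans; [apply Rabs_triang|]. rewrite Rabs_Ropp. lra. }
    assert (Hd : forall m : pt, Rabs (fst m) + Rabs (snd m) <= D -> Rabs (dot m p - dot m p0) <= T).
    { intros m Hm.
      replace (dot m p - dot m p0) with (fst m * (fst p - fst p0) + snd m * (snd p - snd p0))
        by (unfold dot; ring).
      eapply Rle_trans; [apply Rabs_triang|]. rewrite !Rabs_mult. unfold T.
      pose proof (Rabs_pos (fst m)). pose proof (Rabs_pos (snd m)). nra. }
    split; apply Hd; unfold D; lra. }
  assert (Hsgn : exists sg, 0 < sg * F p0).
  { destruct (Rdichotomy _ _ HFp); [exists (-1) | exists 1]; lra. }
  destruct Hsgn as [sg Hsg].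
  (* P need not contain 0, so the positive weight exp(l0 . p) is put in: it turns the integral
     against K^n into a Laplace transform at l0, a frequency of P. *)
  apply (int2_peak rho B C p0 (fun p => sg * F p * exp (dot l0 p)) K HB).
  - apply nice_mult; [apply nice_scal, HF | apply cont2_exp].
  - unfold K. apply cont2_minus; [apply cont2_minus; [apply cont2_const|]|];
      [apply (cont2_comp (fun t => (exp (- dot mu p0) * exp t - 1) ^ 2)) |
       apply (cont2_comp (fun t => (exp (- dot nu p0) * exp t - 1) ^ 2))]; try apply cont2_dot;
      intros t; apply (ex_derive_continuous (V := R_NormedModule)); auto_derive; exact I.
  - apply Hsq.
  - apply Hsq.
  - unfold C. pose proof (pow2_ge_0 (exp T)). lra.
  - rewrite HK, !Rminus_diag, exp_0. ring.
  - intros p H1 H2. rewrite HK. destruct (HT p H1 H2) as [T1 T2].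
    pose proof (exp_minus_1_sqr_le _ _ T1). pose proof (exp_minus_1_sqr_le _ _ T2). unfold C. lra.
  - intros d Hd. set (det := fst mu * snd nu - snd mu * fst nu) in *.
    assert (HT0 : 0 <= T).
    { destruct (HT p0) as [T1 _]; try lra. pose proof (Rabs_pos (dot mu p0 - dot mu p0)). lra. }
    (* Cramer's rule recovers det times p - p0 from the two exponents t1, t2, whence |det| d <= D
       (|t1| + |t2|). The factor 1 + T comes from [exp_minus_1_sqr_ge], and the later kap^2 / 2 from
       x^2 + y^2 >= (x + y)^2 / 2. *)
    set (kap := Rabs det * d / ((D + 1) * (1 + T))).
    assert (HD : 0 <= D) by (unfold D; lra).
    assert (Hkap : 0 < kap).
    { apply Rdiv_lt_0_compat; [|nra]. pose proof (Rabs_pos_lt det Hdet). nra. }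
    exists (kap ^ 2 / 2). split; [pose proof (pow_lt kap 2 Hkap); lra|].
    intros p H1 H2 Hout. rewrite HK. destruct (HT p H1 H2) as [T1 T2].
    pose proof (exp_minus_1_sqr_ge _ _ T1) as E1. pose proof (exp_minus_1_sqr_ge _ _ T2) as E2.
    set (t1 := dot mu p - dot mu p0) in *. set (t2 := dot nu p - dot nu p0) in *.
    assert (Hlin : Rabs det * d <= D * (Rabs t1 + Rabs t2)).
    { pose proof (Rabs_pos t1). pose proof (Rabs_pos t2). pose proof (Rabs_pos det).
      destruct Hout as [Ho|Ho].
      - apply Rle_trans with (Rabs (det * (fst p - fst p0))); [rewrite Rabs_mult; nra|].
        replace (det * (fst p - fst p0)) with (snd nu * t1 + - (snd mu * t2))
          by (unfold det, t1, t2, dot; ring).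
        eapply Rle_trans; [apply Rabs_triang|]. rewrite Rabs_Ropp, !Rabs_mult. unfold D. nra.
      - apply Rle_trans with (Rabs (det * (snd p - snd p0))); [rewrite Rabs_mult; nra|].
        replace (det * (snd p - snd p0)) with (fst mu * t2 + - (fst nu * t1))
          by (unfold det, t1, t2, dot; ring).
        eapply Rle_trans; [apply Rabs_triang|]. rewrite Rabs_Ropp, !Rabs_mult. unfold D. nra. }
    assert (Hk : kap <= Rabs (t1 / (1 + T)) + Rabs (t2 / (1 + T))).
    { unfold Rdiv at 1 2. rewrite !Rabs_mult, (Rabs_pos_eq (/ (1 + T)))
        by (left; apply Rinv_0_lt_compat; lra).
      apply Rmult_le_reg_r with ((D + 1) * (1 + T)); [apply Rmult_lt_0_compat; lra|]. unfold kap.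
      replace (Rabs det * d / ((D + 1) * (1 + T)) * ((D + 1) * (1 + T))) with (Rabs det * d)
        by (field; lra).
      replace ((Rabs t1 * / (1 + T) + Rabs t2 * / (1 + T)) * ((D + 1) * (1 + T)))
        with ((D + 1) * (Rabs t1 + Rabs t2)) by (field; lra).
      pose proof (Rabs_pos t1). pose proof (Rabs_pos t2). nra. }
    rewrite <- (pow2_abs (t1 / _)) in E1. rewrite <- (pow2_abs (t2 / _)) in E2.
    assert (Hk2 : kap ^ 2 <= (Rabs (t1 / (1 + T)) + Rabs (t2 / (1 + T))) ^ 2)
      by (apply pow_incr; lra).
    pose proof (pow2_ge_0 (Rabs (t1 / (1 + T)) - Rabs (t2 / (1 + T)))). lra.
  - intros n.
    pose proof (annihilated_lin B rho sg 0 P F F HB0 HF HF) as HsF.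
    destruct (annihilated_pow B rho C (exp (- dot mu p0)) (exp (- dot nu p0)) P mu nu _
      HB0 Hmu Hnu HsF n) as [_ Hz].
    rewrite <- (Hz l0 Hl0). apply int2_ext. intros p. unfold K. ring.
  - apply Rmult_lt_0_compat; [exact Hsg | apply exp_pos].
Qed.

(** * Recovery of the field from a nonsymmetric transform *)

(** A summand with p_j = 0 equals c_j / e whatever the value of q_j. Any other stays bounded,
    because for small e its denominator keeps at least half of |p_j|. *)
Lemma near_singular (l : list nat) (c p q : nat -> R) :
  (forall j, In j l -> p j = 0 -> q j <> 0) ->
  exists e0 M, 0 < e0 /\ 0 <= M /\ forall e, 0 < e < e0 ->
    (forall j, In j l -> p j + e * q j <> 0) /\
    Rabs (lsum l (fun j => c j * q j / (p j + e * q j)) -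
          lsum l (fun j => if Req_EM_T (p j) 0 then c j else 0) / e) <= M.
Proof.
  induction l as [|j l IH]; intros Hpq.
  - exists 1, 0. repeat split; try lra; [now intros|].
    unfold lsum; simpl. unfold Rdiv. rewrite Rmult_0_l, Rminus_0_r, Rabs_R0. lra.
  - destruct IH as [e0 [M [He0 [HM IH]]]]; [intros; apply Hpq; simpl; auto|].
    specialize (Hpq j (or_introl eq_refl)).
    assert (Hcons : forall f, lsum (j :: l) f = f j + lsum l f) by reflexivity.
    destruct (Req_EM_T (p j) 0) as [Hp|Hp] eqn:Hdec.
    + specialize (Hpq Hp). exists e0, M. repeat split; try assumption.
      * intros i [<-|Hi]; [rewrite Hp; nra|]. now apply IH.
      * rewrite !Hcons, Hdec, Hp. destruct (IH e H) as [_ Hb].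
        replace (c j * q j / (0 + e * q j)) with (c j / e) by (field; lra).
        match goal with |- Rabs (?a + ?b - (?c + ?d) / ?e) <= _ =>
          replace (a + b - (c + d) / e) with (b - d / e) by (field; lra) end.
        exact Hb.
    + assert (Hpp : 0 < Rabs (p j)) by now apply Rabs_pos_lt.
      pose proof (Rabs_pos (q j)) as Hq.
      set (e1 := Rabs (p j) / (2 * (Rabs (q j) + 1))).
      assert (He1 : 0 < e1) by (apply Rdiv_lt_0_compat; lra).
      exists (Rmin e0 e1), (M + Rabs (c j * q j) * (2 / Rabs (p j))).
      pose proof (Rmin_l e0 e1). pose proof (Rmin_r e0 e1).
      assert (Hterm : 0 <= Rabs (c j * q j) * (2 / Rabs (p j))).
      { apply Rmult_le_pos; [apply Rabs_pos|]. left. apply Rdiv_lt_0_compat; lra. }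
      split; [now apply Rmin_glb_lt|]. split; [lra|]. intros e He.
      assert (Hden : Rabs (p j) / 2 <= Rabs (p j + e * q j)).
      { assert (Heq : Rabs (e * q j) <= Rabs (p j) / 2).
        { rewrite Rabs_mult, Rabs_pos_eq by lra.
          assert (e1 * (Rabs (q j) + 1) = Rabs (p j) / 2) by (unfold e1; field; lra). nra. }
        pose proof (Rabs_triang (p j + e * q j) (- (e * q j))) as Ht.
        replace (p j + e * q j + - (e * q j)) with (p j) in Ht by ring.
        rewrite Rabs_Ropp in Ht. lra. }
      destruct (IH e ltac:(lra)) as [Hne Hb]. split.
      * intros i [<-|Hi]; [|now apply Hne]. intros Hz. rewrite Hz, Rabs_R0 in Hden. lra.
      * rewrite !Hcons, Hdec, Rplus_0_l.
        match goal with |- Rabs (?a + ?b - ?d) <= _ =>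
          replace (a + b - d) with ((b - d) + a) by ring end.
        eapply Rle_trans; [apply Rabs_triang|]. apply Rplus_le_compat.
        -- exact Hb.
        -- unfold Rdiv. rewrite Rabs_mult. apply Rmult_le_compat_l; [apply Rabs_pos|].
           rewrite Rabs_inv.
           replace (2 * / Rabs (p j)) with (/ (Rabs (p j) / 2)) by (field; lra).
           apply Rinv_le_contravar; lra.
Qed.

Lemma near_singular_nonzero (l : list nat) (c p q : nat -> R) :
  (forall j, In j l -> p j = 0 -> q j <> 0) ->
  lsum l (fun j => if Req_EM_T (p j) 0 then c j else 0) <> 0 ->
  exists e0, 0 < e0 /\ forall e, 0 < e < e0 ->
    (forall j, In j l -> p j + e * q j <> 0) /\
    lsum l (fun j => c j * q j / (p j + e * q j)) <> 0.
Proof.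
  intros Hpq Hk. destruct (near_singular l c p q Hpq) as [e0 [M [He0 [HM H]]]].
  set (k := lsum l (fun j => if Req_EM_T (p j) 0 then c j else 0)) in *.
  pose proof (Rabs_pos_lt k Hk).
  set (e1 := Rabs k / (M + 1)). assert (He1 : 0 < e1) by (apply Rdiv_lt_0_compat; lra).
  exists (Rmin e0 e1). pose proof (Rmin_l e0 e1). pose proof (Rmin_r e0 e1).
  split; [now apply Rmin_glb_lt|]. intros e He. destruct (H e ltac:(lra)) as [Hne Hb].
  split; [exact Hne|]. intros Hz. rewrite Hz, Rminus_0_l, Rabs_Ropp in Hb.
  unfold Rdiv in Hb. rewrite Rabs_mult, Rabs_inv, (Rabs_pos_eq e) in Hb by lra.
  assert (Rabs k <= M * e).
  { apply (Rmult_le_compat_r e) in Hb; [|lra]. rewrite Rmult_assoc, Rinv_l in Hb; lra. }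
  assert (e1 * (M + 1) = Rabs k) by (unfold e1; field; lra). nra.
Qed.

Lemma lsum_single (l : list nat) (i : nat) (a : nat -> R) : NoDup l -> In i l ->
  (forall j, In j l -> j <> i -> a j = 0) -> lsum l a = a i.
Proof.
  induction 1 as [|j l Hj Hl IH]; [now intros|]. intros Hi Ha.
  change (lsum (j :: l) a) with (a j + lsum l a). destruct Hi as [->|Hi].
  - rewrite (lsum_zero l a); [ring|]. intros k Hk. apply Ha; [now right|]. congruence.
  - rewrite IH, (Ha j); [ring | now left | congruence | exact Hi |].
    intros k Hk. apply Ha. now right.
Qed.

(** * Opposite directions and their pairing *)

Lemma unit_vec_parallel (g g0 : pt) : unit_vec g -> unit_vec g0 -> dot g (perp g0) = 0 ->
  g = g0 \/ g = opp_pt g0.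
Proof.
  unfold unit_vec, dot, perp, opp_pt. destruct g as [x y], g0 as [a b]; cbn [fst snd]. intros Hg H0 H.
  assert (Hx : x = (x * a + y * b) * a).
  { transitivity (x * (a ^ 2 + b ^ 2)); [rewrite H0; ring|].
    transitivity ((x * a + y * b) * a - b * (x * - b + y * a)); [ring | rewrite H; ring]. }
  assert (Hy : y = (x * a + y * b) * b).
  { transitivity (y * (a ^ 2 + b ^ 2)); [rewrite H0; ring|].
    transitivity ((x * a + y * b) * b + a * (x * - b + y * a)); [ring | rewrite H; ring]. }
  set (q := x * a + y * b) in *.
  assert (Hq : (q - 1) * (q + 1) = 0).
  { transitivity (q ^ 2 * (a ^ 2 + b ^ 2) - 1); [rewrite H0; ring|].
    rewrite <- Hg, Hx, Hy. ring. }
  apply Rmult_integral in Hq. destruct Hq as [Hq|Hq]; [left|right]; f_equal; rewrite ?Hx, ?Hy.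
  all: first [replace q with 1 by lra | replace q with (-1) by lra]; ring.
Qed.

Lemma unit_vec_dot_perp (g g0 : pt) : unit_vec g -> unit_vec g0 ->
  dot g (perp g0) = 0 -> dot g g0 <> 0.
Proof.
  unfold unit_vec, dot, perp. destruct g as [x y], g0 as [a b]; cbn [fst snd]. intros Hg H0 H1 H2.
  assert (H : (x ^ 2 + y ^ 2) * (a ^ 2 + b ^ 2) = 0).
  { transitivity ((x * - b + y * a) ^ 2 + (x * a + y * b) ^ 2); [ring|]. rewrite H1, H2. ring. }
  rewrite Hg, H0 in H. lra.
Qed.

(** A unit vector orthogonal to the perpendicular of gamma_0 is gamma_0 or -gamma_0. As the
    directions are distinct, the sum is the weight of i0 alone, or that weight plus the weight of
    the one opposite ray, and neither vanishes. *)
Lemma opposite_weight (m : nat) (gam : nat -> pt) (c : nat -> R) (i0 : nat) :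
  (forall i, (i < m)%nat -> unit_vec (gam i)) ->
  (forall i j, (i < m)%nat -> (j < m)%nat -> gam i = gam j -> i = j) ->
  (forall i, (i < m)%nat -> c i <> 0) -> (i0 < m)%nat ->
  (forall j, (j < m)%nat -> gam j = opp_pt (gam i0) -> c j <> - c i0) ->
  lsum (seq 0 m) (fun j => if Req_EM_T (dot (gam j) (perp (gam i0))) 0 then c j else 0) <> 0.
Proof.
  intros Hunit Hinj Hc Hi0 Hno. set (a := fun j => if Req_EM_T _ 0 then c j else 0).
  assert (Hin : forall j, In j (seq 0 m) <-> (j < m)%nat) by (intros; rewrite in_seq; lia).
  assert (Ha0 : a i0 = c i0).
  { unfold a. destruct Req_EM_T as [_|Hn]; [reflexivity|]. exfalso. apply Hn.
    unfold dot, perp; simpl. ring. }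
  assert (Hcase : forall j, (j < m)%nat -> a j <> 0 -> a j = c j /\ (j = i0 \/ gam j = opp_pt (gam i0))).
  { intros j Hj. unfold a. destruct Req_EM_T as [Hd|Hd]; [|now intros []].
    intros _. split; [reflexivity|].
    destruct (unit_vec_parallel (gam j) (gam i0)) as [H|H]; auto. }
  destruct (classic (exists j, (j < m)%nat /\ gam j = opp_pt (gam i0))) as [[j1 [Hj1 Hg1]]|Hnone].
  - assert (Hne : j1 <> i0).
    { intros ->. specialize (Hunit i0 Hi0). unfold unit_vec in Hunit. unfold opp_pt in Hg1.
      destruct (gam i0) as [x y]; simpl in *. injection Hg1 as Hx Hy. nra. }
    (* Two indices survive; splitting off i0 leaves two sums with one nonzero term each. *)
    set (b := fun j => if Nat.eq_dec j i0 then 0 else a j).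
    set (d := fun j => if Nat.eq_dec j i0 then c i0 else 0).
    rewrite (lsum_ext _ a (fun j => 1 * b j + 1 * d j)).
    + rewrite lsum_lin, (lsum_single _ i0 d), (lsum_single _ j1 b).
      * unfold b, d. destruct (Nat.eq_dec j1 i0) as [|_]; [contradiction|].
        destruct (Nat.eq_dec i0 i0) as [_|]; [|contradiction].
        unfold a. destruct Req_EM_T as [_|Hn].
        -- specialize (Hno j1 Hj1 Hg1). lra.
        -- exfalso. apply Hn. rewrite Hg1. unfold dot, perp, opp_pt; simpl. ring.
      * apply seq_NoDup.
      * now apply Hin.
      * intros j Hj Hjj. unfold b. destruct Nat.eq_dec as [|Hji]; [reflexivity|].
        apply NNPP. intros Haj. destruct (Hcase j) as [_ [H|H]]; [now apply Hin | exact Haj | auto |].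
        apply Hjj, Hinj; [now apply Hin | exact Hj1 | congruence].
      * apply seq_NoDup.
      * now apply Hin.
      * intros j _ Hji. unfold d. now destruct Nat.eq_dec.
    + intros j _. unfold b, d. destruct (Nat.eq_dec j i0) as [->|]; [rewrite Ha0|]; ring.
  - rewrite (lsum_single _ i0 a).
    + rewrite Ha0. now apply Hc.
    + apply seq_NoDup.
    + now apply Hin.
    + intros j Hj Hji. apply NNPP. intros Haj.
      destruct (Hcase j) as [_ [H|H]]; [now apply Hin | exact Haj | auto |].
      apply Hnone. exists j. split; [now apply Hin | exact H].
Qed.

(** Removing the head together with its image leaves a list still closed under the involution. Two
    elements disappear at once, hence the induction on a bound for the length. *)
Lemma pair_up (op : nat -> nat) : forall n l, (length l <= n)%nat -> NoDup l ->
  (forall i, In i l -> In (op i) l /\ op i <> i /\ op (op i) = i) ->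
  exists l1, Permutation l (l1 ++ map op l1).
Proof.
  induction n as [|n IH]; intros [|i l] Hlen Hnd Hop;
    try (exists nil; apply perm_nil); [simpl in Hlen; lia|].
  destruct (Hop i (or_introl eq_refl)) as [[Hi|Hi] [Hne Hinv]]; [congruence|].
  apply in_split in Hi. destruct Hi as [a [b ->]].
  apply NoDup_cons_iff in Hnd. destruct Hnd as [Hi Hnd].
  pose proof (NoDup_remove_1 _ _ _ Hnd) as Hab. pose proof (NoDup_remove_2 _ _ _ Hnd) as Hoi.
  destruct (IH (a ++ b)) as [l1 Hl1].
  - simpl in Hlen. rewrite length_app in *. simpl in Hlen. lia.
  - exact Hab.
  - intros j Hj.
    assert (Hj' : In j (i :: a ++ op i :: b)).
    { right. apply in_app_iff. apply in_app_iff in Hj. simpl. tauto. }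
    destruct (Hop j Hj') as [H1 [H2 H3]]. repeat split; try assumption.
    destruct H1 as [H1|H1].
    + exfalso. apply Hoi. rewrite H1, H3. exact Hj.
    + apply in_app_iff in H1. apply in_app_iff. destruct H1 as [H1|[H1|H1]]; auto.
      exfalso. apply Hi. apply in_app_iff. apply in_app_iff in Hj. simpl.
      assert (i = j) by congruence. subst j. tauto.
  - exists (i :: l1). simpl. constructor.
    eapply Permutation_trans; [symmetry; apply Permutation_middle|].
    eapply Permutation_trans; [|apply Permutation_middle]. now constructor.
Qed.

(** Passing to the partner is an involution since the directions are distinct, and it has no fixed
    point since a unit vector differs from its opposite. Listing one member of each pair and then
    the partners in the same order gives the re-indexing. *)
Lemma symmetric_of_partners (m : nat) (gam : nat -> pt) (c : nat -> R) :
  (forall i, (i < m)%nat -> unit_vec (gam i)) ->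
  (forall i j, (i < m)%nat -> (j < m)%nat -> gam i = gam j -> i = j) ->
  (forall i, (i < m)%nat -> exists j, (j < m)%nat /\ gam j = opp_pt (gam i) /\ c j = - c i) ->
  symmetric m c gam.
Proof.
  intros Hunit Hinj Hpart.
  set (op := fun i => epsilon (inhabits 0%nat)
    (fun j => (j < m)%nat /\ gam j = opp_pt (gam i) /\ c j = - c i)).
  assert (Hop : forall i, (i < m)%nat ->
    (op i < m)%nat /\ gam (op i) = opp_pt (gam i) /\ c (op i) = - c i).
  { intros i Hi. apply epsilon_spec. now apply Hpart. }
  assert (Hin : forall j, In j (seq 0 m) <-> (j < m)%nat) by (intros; rewrite in_seq; lia).
  destruct (pair_up op m (seq 0 m)) as [l1 Hl1].
  - now rewrite length_seq.
  - apply seq_NoDup.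
  - intros i Hi. apply Hin in Hi. destruct (Hop i Hi) as [H1 [H2 _]].
    destruct (Hop (op i) H1) as [H4 [H5 _]]. repeat split.
    + now apply Hin.
    + intros He. rewrite He in H2. specialize (Hunit i Hi). unfold unit_vec in Hunit.
      unfold opp_pt in H2. destruct (gam i) as [x y]; simpl in *. injection H2 as Hx Hy. nra.
    + apply Hinj; [exact H4 | exact Hi |]. rewrite H5, H2. unfold opp_pt; simpl.
      rewrite !Ropp_involutive. now destruct (gam i).
  - set (L := l1 ++ map op l1) in *.
    assert (HlenL : length L = m) by (rewrite <- (Permutation_length Hl1); apply length_seq).
    assert (HndL : NoDup L) by (apply (Permutation_NoDup Hl1), seq_NoDup).
    exists (length l1). split.
    { rewrite <- HlenL. unfold L. rewrite length_app, length_map. lia. }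
    exists (fun i => nth i L 0%nat).
    assert (Hlt : forall i, (i < m)%nat -> (nth i L 0 < m)%nat).
    { intros i Hi. apply Hin. apply (Permutation_in _ (Permutation_sym Hl1)).
      apply nth_In. lia. }
    split; [exact Hlt|]. split.
    + intros i j Hi Hj Hij. apply (proj1 (NoDup_nth L 0%nat) HndL); lia.
    + intros i Hi. unfold L in *. rewrite length_app, length_map in HlenL.
      rewrite (app_nth1 _ _ _ Hi).
      rewrite (app_nth2 l1) by lia.
      replace (length l1 + i - length l1)%nat with i by lia.
      rewrite (nth_indep (map op l1) 0%nat (op 0%nat)) by (now rewrite length_map).
      rewrite map_nth.
      assert (Him : (nth i l1 0 < m)%nat).
      { rewrite <- (app_nth1 l1 (map op l1) 0%nat Hi). apply Hlt. lia. }
      destruct (Hop _ Him) as [_ [-> ->]]. split; [|lra].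
      unfold opp_pt; simpl. rewrite !Ropp_involutive. now destruct (gam (nth i l1 0%nat)).
Qed.

Lemma nice_C2c (r : R) (h : pt -> R) : C2c r h -> nice r h.
Proof.
  intros [[_ [_ [_ [Hh _]]]] [r' [Hr Hs]]]. split; [exact Hh|].
  intros p Hp. apply Hs.
  pose proof (pow2_abs (fst p)). pose proof (pow2_abs (snd p)).
  destruct Hp; nra.
Qed.

Lemma nonsymmetric_unique (rho : R) (m : nat) (gam : nat -> pt) (c : nat -> R) (i0 : nat)
  (F1 F2 : pt -> R) : 0 <= rho ->
  (forall i, (i < m)%nat -> unit_vec (gam i)) ->
  (forall i j, (i < m)%nat -> (j < m)%nat -> gam i = gam j -> i = j) ->
  (forall i, (i < m)%nat -> c i <> 0) -> (i0 < m)%nat ->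
  (forall j, (j < m)%nat -> gam j = opp_pt (gam i0) -> c j <> - c i0) ->
  nice rho F1 -> nice rho F2 ->
  (forall x, lsum (seq 0 m) (fun i => c i * Xray (gam i)
     (fun p => fst (gam i) * F1 p + snd (gam i) * F2 p) x) = 0) ->
  (forall x, lsum (seq 0 m) (fun i => c i * Xray (gam i)
     (fun p => - snd (gam i) * F1 p + fst (gam i) * F2 p) x) = 0) ->
  forall p, F1 p = 0 /\ F2 p = 0.
Proof.
  intros Hrho Hunit Hinj Hc Hi0 Hno H1 H2 Hstar1 Hstar2.
  assert (Hin : forall j, In j (seq 0 m) <-> (j < m)%nat) by (intros; rewrite in_seq; lia).
  set (g0 := gam i0). assert (Hg0 : unit_vec g0) by now apply Hunit.
  destruct (near_singular_nonzero (seq 0 m) c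
    (fun j => dot (gam j) (perp g0)) (fun j => dot (gam j) g0)) as [e0 [He0 Hgood]].
  { intros j Hj. apply Hin in Hj. apply unit_vec_dot_perp; auto. }
  { now apply opposite_weight. }
  set (comb := fun al be : R => addpt (al * fst (perp g0), al * snd (perp g0))
                                     (be * fst g0, be * snd g0)).
  (* The open cone between gamma_0^perp and gamma_0^perp + e0 gamma_0; the ratio be / al is the
     small parameter of [near_singular]. *)
  set (P := fun lam => exists al be, 0 < al /\ 0 < be < e0 * al /\ lam = comb al be).
  set (B := rho + 1 + INR m + 1). pose proof (pos_INR m) as Hm.
  assert (Hlap : forall lam, P lam -> lap B lam F1 = 0 /\ lap B lam F2 = 0).
  { intros lam [al [be [Hal [Hbe ->]]]].
    assert (Hratio : 0 < be / al < e0).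
    { split; [apply Rdiv_lt_0_compat; lra|].
      apply Rmult_lt_reg_r with al; [exact Hal|].
      replace (be / al * al) with be by (field; lra). lra. }
    destruct (Hgood _ Hratio) as [Hne Hsum].
    assert (Hdot : forall j, dot (gam j) (comb al be) =
      al * (dot (gam j) (perp g0) + be / al * dot (gam j) g0)).
    { intros j. unfold comb, addpt, dot; simpl. field. lra. }
    assert (Hne' : forall j, In j (seq 0 m) -> dot (gam j) (comb al be) <> 0).
    { intros j Hj. rewrite Hdot. apply Rmult_integral_contrapositive_currified; [lra|]. now apply Hne. }
    (* A1 - i A2 is the complex factor multiplying the transform L1 + i L2 of the field; E1 and E2
       below are the real and imaginary parts of their vanishing product. *)
    set (A1 := lsum (seq 0 m) (fun i => c i * fst (gam i) / dot (gam i) (comb al be))).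
    set (A2 := lsum (seq 0 m) (fun i => c i * snd (gam i) / dot (gam i) (comb al be))).
    (* The component of (A1, A2) along g0 is, up to the factor 1 / al, the sum shown to be nonzero
       by [near_singular_nonzero], so the complex factor is not 0. *)
    assert (HA : fst g0 * A1 + snd g0 * A2 <> 0).
    { unfold A1, A2. rewrite <- lsum_lin.
      rewrite (lsum_ext _ _ (fun j => / al * (c j * dot (gam j) g0 /
        (dot (gam j) (perp g0) + be / al * dot (gam j) g0)) + 0 * 0)).
      - rewrite lsum_lin, Rmult_0_l, Rplus_0_r.
        apply Rmult_integral_contrapositive_currified; [apply Rinv_neq_0_compat; lra | exact Hsum].
      - intros j Hj. specialize (Hne j Hj). rewrite Hdot.
        set (den := dot (gam j) (perp g0) + be / al * dot (gam j) g0) in *.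
        unfold dot. field. split; [exact Hne | lra]. }
    assert (Hbeam : forall v1 v2 : nat -> R,
      (forall x, lsum (seq 0 m) (fun i => c i * Xray (gam i) (fun p => v1 i * F1 p + v2 i * F2 p) x) = 0) ->
      lap B (comb al be) F1 * lsum (seq 0 m) (fun i => c i * v1 i / dot (gam i) (comb al be)) +
      lap B (comb al be) F2 * lsum (seq 0 m) (fun i => c i * v2 i / dot (gam i) (comb al be)) = 0).
    { intros v1 v2 Hv. rewrite <- lsum_lin.
      rewrite <- (lap_beams rho B (comb al be) gam c (fun i p => v1 i * F1 p + v2 i * F2 p) (seq 0 m)).
      - apply lsum_ext. intros i Hi.
        rewrite (lap_plus rho), !(lap_scal rho) by (try apply nice_scal; try assumption; unfold B; lra).
        field. now apply Hne'.
      - exact Hrho.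
      - rewrite length_seq. unfold B. lra.
      - intros i Hi. apply Hin in Hi. now apply Hunit.
      - exact Hne'.
      - intros i Hi. apply nice_plus; now apply nice_scal.
      - exact Hv. }
    set (L1 := lap B (comb al be) F1) in *. set (L2 := lap B (comb al be) F2) in *.
    assert (E1 : L1 * A1 + L2 * A2 = 0) by exact (Hbeam _ _ Hstar1).
    assert (E2 : L1 * (-1 * A2) + L2 * A1 = 0).
    { replace (-1 * A2) with (lsum (seq 0 m) (fun i => c i * - snd (gam i) / dot (gam i) (comb al be))).
      - exact (Hbeam _ _ Hstar2).
      - rewrite (lsum_ext _ _
          (fun i => (-1) * (c i * snd (gam i) / dot (gam i) (comb al be)) + 0 * 0)).
        + rewrite lsum_lin. fold A2. ring.
        + intros i Hi. field. now apply Hne'. }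
    assert (HAA : A1 * A1 + A2 * A2 <> 0).
    { intros Hz. assert (A1 = 0) by nra. assert (A2 = 0) by nra. apply HA; nra. }
    split; apply Rmult_eq_reg_r with (2 := HAA); rewrite Rmult_0_l.
    - transitivity ((L1 * A1 + L2 * A2) * A1 - (L1 * (-1 * A2) + L2 * A1) * A2); [ring|].
      rewrite E1, E2. ring.
    - transitivity ((L1 * A1 + L2 * A2) * A2 + (L1 * (-1 * A2) + L2 * A1) * A1); [ring|].
      rewrite E1, E2. ring. }
  assert (HPadd : forall be, 0 < be < e0 -> forall lam, P lam -> P (addpt lam (comb 1 be))).
  { intros be Hbe lam [al [be' [Hal [Hbe' ->]]]]. exists (al + 1), (be' + be).
    split; [lra|]. split; [nra|]. unfold comb, addpt; simpl. f_equal; ring. }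
  (* Two different slopes inside the cone give independent frequencies mu and nu; the first of them
     also serves as the base frequency l0. *)
  assert (HP0 : P (comb 1 (e0 / 3))).
  { exists 1, (e0 / 3). repeat split; lra. }
  assert (Hdet : fst (comb 1 (e0 / 3)) * snd (comb 1 (e0 * 2 / 3)) -
                 snd (comb 1 (e0 / 3)) * fst (comb 1 (e0 * 2 / 3)) <> 0).
  { unfold comb, addpt, perp; simpl. unfold unit_vec in Hg0.
    replace (_ - _) with (- (e0 / 3) * (fst g0 ^ 2 + snd g0 ^ 2)) by field. rewrite Hg0. lra. }
  assert (Hzero : forall F, nice rho F -> (forall lam, P lam -> lap B lam F = 0) -> forall p, F p = 0).
  { intros F HF HFz. apply (lap_cone_unique B rho P F _ _ _) with (2 := HP0) (3 := Hdet).
    - unfold B. lra.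
    - apply HPadd. lra.
    - apply HPadd. lra.
    - now split. }
  intros p. split.
  - apply (Hzero F1 H1). intros lam Hl. exact (proj1 (Hlap lam Hl)).
  - apply (Hzero F2 H2). intros lam Hl. exact (proj2 (Hlap lam Hl)).
Qed.

Lemma invertible_of_nonsymmetric (r : R) (m : nat) (gam : nat -> pt) (c : nat -> R) : 0 < r ->
  (forall i, (i < m)%nat -> unit_vec (gam i)) ->
  (forall i j, (i < m)%nat -> (j < m)%nat -> gam i = gam j -> i = j) ->
  (forall i, (i < m)%nat -> c i <> 0) ->
  ~ symmetric m c gam -> invertible r m c gam.
Proof.
  intros Hr Hunit Hinj Hc Hns f g [Hf1 Hf2] [Hg1 Hg2] Hfg.
  apply nice_C2c in Hf1, Hf2, Hg1, Hg2.
  assert (Hin : forall j, In j (seq 0 m) <-> (j < m)%nat) by (intros; rewrite in_seq; lia).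
  assert (Hi0 : exists i0, (i0 < m)%nat /\
    forall j, (j < m)%nat -> gam j = opp_pt (gam i0) -> c j <> - c i0).
  { apply NNPP. intros Hn. apply Hns. apply symmetric_of_partners; [exact Hunit | exact Hinj |].
    intros i Hi. apply NNPP. intros Hn'. apply Hn. exists i. split; [exact Hi|].
    intros j Hj Hgj Hcj. apply Hn'. now exists j. }
  destruct Hi0 as [i0 [Hi0 Hno]].
  assert (Hlin : forall v : nat -> pt,
    (forall x, lsum (seq 0 m) (fun i => c i * Xray (gam i) (fun p => dot (f p) (v i)) x) =
               lsum (seq 0 m) (fun i => c i * Xray (gam i) (fun p => dot (g p) (v i)) x)) ->
    forall x, lsum (seq 0 m) (fun i => c i * Xray (gam i)
      (fun p => fst (v i) * (fst (f p) - fst (g p)) + snd (v i) * (snd (f p) - snd (g p))) x) = 0).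
  { intros v Hv x.
    assert (Hnice : forall (h : pt -> pt) i, nice r (fun p => fst (h p)) -> nice r (fun p => snd (h p)) ->
      nice r (fun p => dot (h p) (v i))).
    { intros h i N1 N2. unfold dot.
      apply (nice_plus r (fun p => fst (h p) * fst (v i)) (fun p => snd (h p) * snd (v i)));
        (apply nice_mult; [assumption | apply cont2_const]). }
    rewrite (lsum_ext _ _ (fun i =>
      1 * (c i * Xray (gam i) (fun p => dot (f p) (v i)) x) +
      (-1) * (c i * Xray (gam i) (fun p => dot (g p) (v i)) x))).
    - rewrite lsum_lin, Hv. ring.
    - intros i Hi. apply Hin in Hi.
      replace (fun p => fst (v i) * (fst (f p) - fst (g p)) + snd (v i) * (snd (f p) - snd (g p)))
        with (fun p => 1 * dot (f p) (v i) + (-1) * dot (g p) (v i))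
        by (apply functional_extensionality; intros p; unfold dot; ring).
      rewrite (Xray_lin r 1 (-1) (gam i) x (fun p => dot (f p) (v i)) (fun p => dot (g p) (v i)))
        by auto. ring. }
  pose proof (nonsymmetric_unique r m gam c i0 (fun p => fst (f p) - fst (g p))
    (fun p => snd (f p) - snd (g p)) (Rlt_le _ _ Hr) Hunit Hinj Hc Hi0 Hno
    (nice_minus _ _ _ Hf1 Hg1) (nice_minus _ _ _ Hf2 Hg2)) as Huniq.
  apply functional_extensionality. intros p.
  destruct (Huniq) with (p := p) as [E1 E2].
  - apply (Hlin gam). intros x. exact (f_equal fst (equal_f Hfg x)).
  - apply (Hlin (fun i => perp (gam i))). intros x. exact (f_equal snd (equal_f Hfg x)).
  - destruct (f p), (g p); simpl in *. f_equal; lra.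
Qed.

(** * Fields invisible to a symmetric transform *)

Lemma is_derive_translate (f : R -> R) (v x : R) : ex_derive f (x + v) ->
  is_derive (fun t => f (t + v)) x (Derive f (x + v)).
Proof.
  intros Hf. apply Derive_correct in Hf. rewrite <- (Rmult_1_l (Derive f (x + v))).
  apply (is_derive_comp (V := R_NormedModule) f (fun t => t + v) x); [exact Hf|].
  auto_derive; [exact I | ring].
Qed.

Lemma has_partials_trans (g : pt) (s : R) (h : pt -> R) :
  has_partials h -> has_partials (trans g s h).
Proof.
  intros Hh p. destruct (Hh (ray p g s)) as [H1 H2]. split; eexists.
  - exact (is_derive_translate (fun t => h (t, snd p + s * snd g)) (s * fst g) (fst p) H1).
  - exact (is_derive_translate (fun t => h (fst p + s * fst g, t)) (s * snd g) (snd p) H2).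
Qed.

Lemma d1_trans (g : pt) (s : R) (h : pt -> R) : has_partials h ->
  Defs.d1 (trans g s h) = trans g s (Defs.d1 h).
Proof.
  intros Hh. apply functional_extensionality. intros p. destruct (Hh (ray p g s)) as [H1 _].
  apply is_derive_unique.
  exact (is_derive_translate (fun t => h (t, snd p + s * snd g)) (s * fst g) (fst p) H1).
Qed.

Lemma d2_trans (g : pt) (s : R) (h : pt -> R) : has_partials h ->
  Defs.d2 (trans g s h) = trans g s (Defs.d2 h).
Proof.
  intros Hh. apply functional_extensionality. intros p. destruct (Hh (ray p g s)) as [_ H2].
  apply is_derive_unique.
  exact (is_derive_translate (fun t => h (fst p + s * fst g, t)) (s * snd g) (snd p) H2).
Qed.

Lemma C2_trans (g : pt) (s : R) (h : pt -> R) : C2 h -> C2 (trans g s h).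
Proof.
  unfold C2. intros [H [H1 [H2 Hc]]].
  rewrite !d1_trans, !d2_trans, !d1_trans by assumption.
  repeat match goal with |- _ /\ _ => split end;
    first [apply has_partials_trans; assumption | apply cont2_trans; apply Hc].
Qed.

Lemma has_partials_minus (h k : pt -> R) : has_partials h -> has_partials k ->
  has_partials (fun p => h p - k p).
Proof.
  intros Hh Hk p. destruct (Hh p) as [H1 H2], (Hk p) as [K1 K2].
  split; apply (ex_derive_minus (V := R_NormedModule)); assumption.
Qed.

Lemma d1_minus (h k : pt -> R) : has_partials h -> has_partials k ->
  Defs.d1 (fun p => h p - k p) = fun p => Defs.d1 h p - Defs.d1 k p.
Proof.
  intros Hh Hk. apply functional_extensionality. intros p.
  exact (Derive_minus _ _ _ (proj1 (Hh p)) (proj1 (Hk p))).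
Qed.

Lemma d2_minus (h k : pt -> R) : has_partials h -> has_partials k ->
  Defs.d2 (fun p => h p - k p) = fun p => Defs.d2 h p - Defs.d2 k p.
Proof.
  intros Hh Hk. apply functional_extensionality. intros p.
  exact (Derive_minus _ _ _ (proj2 (Hh p)) (proj2 (Hk p))).
Qed.

Lemma C2_minus (h k : pt -> R) : C2 h -> C2 k -> C2 (fun p => h p - k p).
Proof.
  unfold C2. intros [H [H1 [H2 Hc]]] [K [K1 [K2 Kc]]].
  rewrite !d1_minus, !d2_minus, !d1_minus by assumption.
  repeat match goal with |- _ /\ _ => split end;
    first [apply has_partials_minus; assumption | apply cont2_minus; [apply Hc | apply Kc]].
Qed.

Lemma partials_product (u u' v v' : R -> R) :
  (forall t, is_derive u t (u' t)) -> (forall t, is_derive v t (v' t)) ->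
  has_partials (fun p => u (fst p) * v (snd p)) /\
  Defs.d1 (fun p => u (fst p) * v (snd p)) = (fun p => u' (fst p) * v (snd p)) /\
  Defs.d2 (fun p => u (fst p) * v (snd p)) = (fun p => u (fst p) * v' (snd p)).
Proof.
  intros Hu Hv.
  assert (H1 : forall k x, is_derive (fun t => u t * k) x (u' x * k)).
  { intros k x. replace (u' x * k) with (scal k (u' x)) by (apply Rmult_comm).
    apply is_derive_ext with (f := fun t => scal k (u t)); [intros; apply Rmult_comm|].
    now apply (is_derive_scal u x k). }
  assert (H2 : forall k x, is_derive (fun t => k * v t) x (k * v' x)).
  { intros k x. now apply (is_derive_scal v x k). }
  split; [|split].
  - intros p. split; eexists; [exact (H1 (v (snd p)) (fst p)) | exact (H2 (u (fst p)) (snd p))].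
  - apply functional_extensionality. intros p.
    exact (is_derive_unique _ _ _ (H1 (v (snd p)) (fst p))).
  - apply functional_extensionality. intros p.
    exact (is_derive_unique _ _ _ (H2 (u (fst p)) (snd p))).
Qed.

Lemma C2_product (u u' u'' : R -> R) : (forall t, is_derive u t (u' t)) ->
  (forall t, is_derive u' t (u'' t)) -> continuous_all u'' ->
  C2 (fun p => u (fst p) * u (snd p)).
Proof.
  intros Hu Hu' Hc''.
  assert (Hc : continuous_all u).
  { intros t. apply (ex_derive_continuous (V := R_NormedModule)). eexists. apply Hu. }
  assert (Hc' : continuous_all u').
  { intros t. apply (ex_derive_continuous (V := R_NormedModule)). eexists. apply Hu'. }
  assert (Hprod : forall a b, continuous_all a -> continuous_all b ->
    cont2 (fun p => a (fst p) * b (snd p))).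
  { intros a b Ha Hb. apply cont2_mult; [now apply cont2_fst | now apply cont2_snd]. }
  destruct (partials_product u u' u u' Hu Hu) as [P [E1 E2]].
  destruct (partials_product u' u'' u u' Hu' Hu) as [P1 [E11 E12]].
  destruct (partials_product u u' u' u'' Hu Hu') as [P2 [E21 E22]].
  unfold C2. rewrite E1, E2, E11, E12, E21, E22.
  repeat match goal with |- _ /\ _ => split end; try assumption; now apply Hprod.
Qed.

(** * A twice continuously differentiable bump *)

Lemma continuous_Rmax0 : continuous_all (Rmax 0).
Proof.
  intros x. apply continuous_eps. intros eps Heps. exists eps. split; [exact Heps|].
  intros y. unfold Rmax, Rabs. repeat destruct Rle_dec; repeat destruct Rcase_abs; lra.
Qed.

Lemma is_derive_Rmax0_2 (x : R) : is_derive (fun t => Rmax 0 t ^ 2) x (2 * Rmax 0 x).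
Proof.
  apply is_derive_Reals. intros eps Heps. exists (mkposreal eps Heps). intros h Hh Hhe.
  simpl in Hhe.
  assert (Hq : Rabs (Rmax 0 (x + h) ^ 2 - Rmax 0 x ^ 2 - 2 * Rmax 0 x * h) <= Rabs h ^ 2).
  { rewrite pow2_abs. unfold Rmax. repeat destruct Rle_dec; apply Rabs_le; nra. }
  replace ((Rmax 0 (x + h) ^ 2 - Rmax 0 x ^ 2) / h - 2 * Rmax 0 x)
    with ((Rmax 0 (x + h) ^ 2 - Rmax 0 x ^ 2 - 2 * Rmax 0 x * h) / h) by (field; exact Hh).
  unfold Rdiv. rewrite Rabs_mult, Rabs_inv. pose proof (Rabs_pos_lt h Hh).
  apply Rmult_lt_reg_r with (Rabs h); [assumption|]. rewrite Rmult_assoc, Rinv_l by lra. nra.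
Qed.

(** Written as t times the square of the positive part, the cube yields to the product rule, with no
    second estimate at the kink. *)
Lemma is_derive_Rmax0_3 (x : R) : is_derive (fun t => Rmax 0 t ^ 3) x (3 * Rmax 0 x ^ 2).
Proof.
  apply (is_derive_ext (fun t => t * Rmax 0 t ^ 2)).
  { intros t. unfold Rmax. destruct Rle_dec; ringR. }
  replace (3 * Rmax 0 x ^ 2) with (1 * Rmax 0 x ^ 2 + x * (2 * Rmax 0 x)).
  - apply (is_derive_mult (fun t => t) (fun t => Rmax 0 t ^ 2));
      [apply (is_derive_id (K := R_AbsRing)) | apply is_derive_Rmax0_2 | apply Rmult_comm].
  - unfold Rmax. destruct Rle_dec; ring.
Qed.

Lemma is_derive_compR (f g : R -> R) (x df dg : R) : is_derive f (g x) df -> is_derive g x dg ->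
  is_derive (fun t => f (g t)) x (dg * df).
Proof. intros Hf Hg. exact (is_derive_comp (V := R_NormedModule) f g x df dg Hf Hg). Qed.

Lemma exists_bump (r : R) : 0 < r -> exists h, C2c r h /\ exists p, h p <> 0.
Proof.
  (* The square of half-width r/3 lies in the disc of radius r/2, because 2/9 < 1/4. *)
  intros Hr. set (e := r / 3).
  set (w := fun t => e ^ 2 - t ^ 2).
  assert (Hw : forall t, is_derive w t (- (2 * t))).
  { intros t. unfold w. auto_derive; [exact I | ring]. }
  (* The third power is the first integer power of the positive part that is twice continuously
     differentiable. *)
  set (b := fun t => Rmax 0 (w t) ^ 3).
  exists (fun p => b (fst p) * b (snd p)). split; [split|].
  - apply C2_product with (u' := fun t => - (2 * t) * (3 * Rmax 0 (w t) ^ 2))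
      (u'' := fun t => (-6) * Rmax 0 (w t) ^ 2 + (-6 * t) * (- (2 * t) * (2 * Rmax 0 (w t)))).
    + intros t. apply (is_derive_compR (fun t => Rmax 0 t ^ 3) w); [apply is_derive_Rmax0_3 | apply Hw].
    + intros t. apply (is_derive_ext (fun t => (-6 * t) * Rmax 0 (w t) ^ 2)).
      { intros s. ringR. }
      apply (is_derive_mult (fun t => -6 * t) (fun t => Rmax 0 (w t) ^ 2)).
      * auto_derive; [exact I | ring].
      * apply (is_derive_compR (fun t => Rmax 0 t ^ 2) w); [apply is_derive_Rmax0_2 | apply Hw].
      * apply Rmult_comm.
    + assert (Hm : continuous_all (fun t => Rmax 0 (w t))).
      { intros t. apply (continuous_comp w (Rmax 0)); [|apply continuous_Rmax0].
        apply (ex_derive_continuous (V := R_NormedModule)). eexists. apply Hw. }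
      intros t. apply (continuous_plus (fun t => (-6) * Rmax 0 (w t) ^ 2)
        (fun t => (-6 * t) * (- (2 * t) * (2 * Rmax 0 (w t))))).
      * apply (continuous_comp (fun t => Rmax 0 (w t)) (fun y => -6 * y ^ 2)); [apply Hm|].
        apply (ex_derive_continuous (V := R_NormedModule)). auto_derive. exact I.
      * apply (continuous_ext (fun t => (24 * t ^ 2) * Rmax 0 (w t))); [intros; ringR|].
        apply (continuous_mult (fun t => 24 * t ^ 2) (fun t => Rmax 0 (w t))); [|apply Hm].
        apply (ex_derive_continuous (V := R_NormedModule)). auto_derive. exact I.
  - exists (r / 2). split; [lra|]. intros p Hp.
    assert (Hb0 : forall t, e ^ 2 <= t ^ 2 -> b t = 0).
    { intros t Ht. unfold b, w. rewrite Rmax_left by lra. ring. }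
    destruct (Rle_dec (e ^ 2) (fst p ^ 2)) as [H1|H1]; [rewrite (Hb0 _ H1); ring|].
    destruct (Rle_dec (e ^ 2) (snd p ^ 2)) as [H2|H2]; [rewrite (Hb0 _ H2); ring|].
    exfalso. unfold e in *. nra.
  - exists (0, 0). unfold b, w; simpl. assert (0 < e) by (unfold e; lra).
    rewrite Rmax_right by nra. assert (0 < e * (e * 1) - 0 * (0 * 1)) by nra.
    apply Rmult_integral_contrapositive_currified;
      apply (pow_nonzero _ 3); lra.
Qed.

(** Two opposite beams from x make up the integral over the full line through x, so this is the
    vanishing of the classical X-ray transform in direction g. *)
Definition line_null (g : pt) (h : pt -> R) : Prop :=
  forall x, Xray g h x + Xray (opp_pt g) h x = 0.

Lemma unit_vec_opp (g : pt) : unit_vec g -> unit_vec (opp_pt g).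
Proof.
  unfold unit_vec, opp_pt; cbn [fst snd]. intros H. transitivity (fst g ^ 2 + snd g ^ 2); [ring | exact H].
Qed.

Lemma Xray_diff (rho s : R) (g v x : pt) (h : pt -> R) : unit_vec g -> unit_vec v -> 0 <= s ->
  nice rho h -> Xray g (diff v s h) x = diff v s (Xray g h) x.
Proof.
  intros Hg Hv Hs Hh.
  replace (diff v s h) with (fun p => 1 * trans v s h p + (-1) * h p)
    by (apply functional_extensionality; intros; unfold diff; ring).
  rewrite (Xray_lin (rho + s)) by
    (try apply nice_trans; try (apply (nice_weaken rho); [lra|]); assumption).
  unfold diff, trans at 2.
  replace (Xray g (trans v s h) x) with (Xray g h (ray x v s)); [ring|].
  unfold Xray. f_equal. apply functional_extensionality. intros t.
  unfold trans, ray; simpl. do 2 f_equal; ring.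
Qed.

Lemma line_null_diff (rho s : R) (g v : pt) (h : pt -> R) : unit_vec g -> unit_vec v -> 0 <= s ->
  nice rho h -> line_null g h -> line_null g (diff v s h).
Proof.
  intros Hg Hv Hs Hh H x. pose proof (unit_vec_opp g Hg).
  rewrite !(Xray_diff rho) by assumption. unfold diff, trans.
  pose proof (H x). pose proof (H (ray x v s)). lra.
Qed.

Lemma line_null_diff_self (rho s : R) (g : pt) (h : pt -> R) : unit_vec g -> 0 <= s ->
  nice rho h -> line_null g (diff g s h).
Proof.
  intros Hg Hs Hh x. pose proof (unit_vec_opp g Hg) as Hg'.
  rewrite !(Xray_diff rho) by assumption. rewrite (diff_Xray rho) by assumption.
  (* From y a step s along -g leads back to x. The difference of the backward beam at x is thus
     minus the one taken from y, and it covers the same segment in reverse, cancelling the forward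
     contribution. *)
  set (y := ray x g s).
  assert (Hback : forall t, ray y (opp_pt g) t = ray x g (s - t)).
  { intros t. unfold y, ray, opp_pt; simpl. f_equal; ring. }
  replace (diff g s (Xray (opp_pt g) h) x) with (- diff (opp_pt g) s (Xray (opp_pt g) h) y).
  - rewrite (diff_Xray rho) by assumption. unfold segint.
    rewrite (RInt_ext (fun t => h (ray y (opp_pt g) t)) (fun t => (fun t => h (ray x g t)) (s - t)))
      by (intros t _; now rewrite Hback).
    rewrite (RInt_reflect (fun t => h (ray x g t))) by apply continuous_ray, Hh.
    rewrite Rminus_diag, Rminus_0_r. ring.
  - unfold diff, trans. rewrite Hback.
    replace (ray x g (s - s)) with x; [fold y; ring|].
    unfold ray. destruct x; simpl. f_equal; ring.
Qed.

(** A vanishing difference makes h periodic along g with period s, and enough periods lead out of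
    the support. Hence differencing cannot destroy a nonzero field. *)
Lemma diff_zero (rho s : R) (g : pt) (h : pt -> R) : unit_vec g -> 0 < s -> nice rho h ->
  (forall p, diff g s h p = 0) -> forall p, h p = 0.
Proof.
  intros Hg Hs [_ Sh] H p.
  assert (Hn : forall n, h (ray p g (INR n * s)) = h p).
  { induction n as [|n IH].
    - simpl. f_equal. unfold ray. destruct p; simpl. f_equal; ring.
    - rewrite <- IH. specialize (H (ray p g (INR n * s))). unfold diff, trans in H.
      rewrite ray_ray in H. rewrite S_INR.
      replace ((INR n + 1) * s) with (s + INR n * s) by ring. lra. }
  set (b := Rabs rho + Rabs (fst p) + Rabs (snd p)).
  destruct (INR_unbounded ((2 * b + 1) / s)) as [N HN]. rewrite <- (Hn N). apply Sh.
  assert (HNs : 2 * b + 1 < INR N * s).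
  { apply (Rmult_lt_compat_r s) in HN; [|exact Hs].
    replace ((2 * b + 1) / s * s) with (2 * b + 1) in HN by (field; lra). exact HN. }
  set (t := INR N * s) in *. unfold ray; simpl. unfold unit_vec in Hg.
  pose proof (Rle_abs rho). pose proof (Rabs_pos rho).
  pose proof (Rabs_pos (fst p)). pose proof (Rabs_pos (snd p)).
  apply NNPP. intros Hin.
  assert (B1 : Rabs (fst p + t * fst g) <= rho) by (apply Rnot_lt_le; tauto).
  assert (B2 : Rabs (snd p + t * snd g) <= rho) by (apply Rnot_lt_le; tauto).
  assert (Hstep : forall y d, Rabs (y + t * d) <= rho -> Rabs (t * d) <= rho + Rabs y).
  { intros y d Hd. replace (t * d) with ((y + t * d) + - y) by ring.
    eapply Rle_trans; [apply Rabs_triang|]. rewrite Rabs_Ropp. lra. }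
  apply Hstep in B1, B2.
  assert (Q1 : (t * fst g) ^ 2 <= b ^ 2).
  { rewrite <- (pow2_abs (t * fst g)). apply pow_incr. split; [apply Rabs_pos|]. unfold b. lra. }
  assert (Q2 : (t * snd g) ^ 2 <= b ^ 2).
  { rewrite <- (pow2_abs (t * snd g)). apply pow_incr. split; [apply Rabs_pos|]. unfold b. lra. }
  assert (Ht : t ^ 2 <= 2 * b ^ 2).
  { replace (t ^ 2) with (t ^ 2 * (fst g ^ 2 + snd g ^ 2)) by (rewrite Hg; ring).
    rewrite Rpow_mult_distr in Q1, Q2. lra. }
  assert (0 <= b) by (unfold b; lra). nra.
Qed.

(** The reverse triangle inequality |p + s g| >= |p| - s, with Cauchy-Schwarz obtained from
    Lagrange's identity. *)
Lemma norm_ray_ge (a s : R) (g p : pt) : unit_vec g -> 0 <= a -> 0 <= s ->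
  fst p ^ 2 + snd p ^ 2 > (a + s) ^ 2 ->
  fst (ray p g s) ^ 2 + snd (ray p g s) ^ 2 > a ^ 2.
Proof.
  unfold unit_vec, ray; simpl. destruct p as [x y], g as [u v]; cbn [fst snd]. intros Hg Ha Hs H.
  set (n := sqrt (x ^ 2 + y ^ 2)).
  assert (Hn0 : 0 <= n) by apply sqrt_pos.
  assert (Hn2 : n ^ 2 = x ^ 2 + y ^ 2) by (apply pow2_sqrt; nra).
  assert (Hn : a + s < n) by nra.
  assert (Hcs : (x * u + y * v) ^ 2 <= n ^ 2).
  { rewrite Hn2. pose proof (pow2_ge_0 (x * v - y * u)).
    replace (x ^ 2 + y ^ 2) with ((x ^ 2 + y ^ 2) * (u ^ 2 + v ^ 2)) by (simpl in *; nra). nra. }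
  assert (Hcs' : - n <= x * u + y * v) by nra.
  assert (Hexp : (x + s * u) ^ 2 + (y + s * v) ^ 2 = n ^ 2 + 2 * s * (x * u + y * v) + s ^ 2 * (u ^ 2 + v ^ 2))
    by (rewrite Hn2; ring).
  replace (u ^ 2 + v ^ 2) with 1 in Hexp by (simpl in *; lra).
  assert (H1 : (n - s) ^ 2 <= (x + s * u) ^ 2 + (y + s * v) ^ 2) by (rewrite Hexp; nra).
  assert (H2 : a ^ 2 < (n - s) ^ 2) by nra.
  simpl in *. lra.
Qed.

Lemma C2c_diff (r s : R) (g : pt) (h : pt -> R) : unit_vec g -> 0 <= s -> C2c r h ->
  C2c (r + s) (diff g s h).
Proof.
  intros Hg Hs [Hh [r' [Hr Hsup]]]. split; [apply C2_minus; [now apply C2_trans | exact Hh]|].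
  exists (r' + s). split; [lra|]. intros p Hp. unfold diff, trans.
  rewrite (Hsup (ray p g s)), (Hsup p); [ring | nra |].
  apply (norm_ray_ge r' s g p); try assumption; lra.
Qed.

(** Half of the radius is left to the function built for the remaining directions, and half is spent
    as the step of the new difference. Differences along other directions preserve the null
    integrals already achieved. *)
Lemma exists_line_null (gam : nat -> pt) (l : list nat) :
  (forall i, In i l -> unit_vec (gam i)) -> forall r, 0 < r ->
  exists h, C2c r h /\ (exists p, h p <> 0) /\ forall i, In i l -> line_null (gam i) h.
Proof.
  induction l as [|i l IH]; intros Hunit r Hr.
  - destruct (exists_bump r Hr) as [h [H1 H2]]. exists h.
    split; [exact H1 | split; [exact H2 | now intros]].
  - destruct (IH (fun j Hj => Hunit j (or_intror Hj)) (r / 2)) as [h [H1 [[p Hp] H3]]]; [lra|].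
    pose proof (Hunit i (or_introl eq_refl)) as Hg.
    pose proof (nice_C2c _ _ H1) as Hn.
    exists (diff (gam i) (r / 2) h). split; [|split].
    + replace r with (r / 2 + r / 2) at 1 by field. apply C2c_diff; [exact Hg | lra | exact H1].
    + apply NNPP. intros Hnone. apply Hp.
      apply (diff_zero (r / 2) (r / 2) (gam i) h); [exact Hg | lra | exact Hn|].
      intros q. apply NNPP. intros Hq. apply Hnone. now exists q.
    + intros j [<-|Hj].
      * apply (line_null_diff_self (r / 2)); [exact Hg | lra | exact Hn].
      * apply (line_null_diff (r / 2)); [apply Hunit; now right | exact Hg | lra | exact Hn | now apply H3].
Qed.

(** * Summation over opposite pairs and the conclusion *)

Lemma lsum_perm (l l' : list nat) (a : nat -> R) : Permutation l l' -> lsum l a = lsum l' a.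
Proof. unfold lsum. induction 1; simpl; lra. Qed.

Lemma lsum_app (l l' : list nat) (a : nat -> R) : lsum (l ++ l') a = lsum l a + lsum l' a.
Proof. unfold lsum. induction l as [|i l IH]; simpl; [|rewrite IH]; ring. Qed.

Lemma lsum_map (l : list nat) (sigma : nat -> nat) (a : nat -> R) :
  lsum (map sigma l) a = lsum l (fun i => a (sigma i)).
Proof. unfold lsum. now rewrite map_map. Qed.

Lemma seq_map_add (k s n : nat) : seq (k + s) n = map (fun i => (k + i)%nat) (seq s n).
Proof.
  revert s. induction n as [|n IH]; intros s; simpl; [reflexivity|]. f_equal.
  rewrite <- IH. f_equal. lia.
Qed.

(** An injective self-map of a finite index set is a permutation, so the sum may be reordered and
    its two halves added term by term. *)
Lemma lsum_pairs (k : nat) (sigma : nat -> nat) (a : nat -> R) :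
  (forall i, (i < 2 * k)%nat -> (sigma i < 2 * k)%nat) ->
  (forall i j, (i < 2 * k)%nat -> (j < 2 * k)%nat -> sigma i = sigma j -> i = j) ->
  (forall i, (i < k)%nat -> a (sigma i) + a (sigma (k + i)%nat) = 0) ->
  lsum (seq 0 (2 * k)) a = 0.
Proof.
  intros Hlt Hinj Hpair.
  assert (Hin : forall j, In j (seq 0 (2 * k)) <-> (j < 2 * k)%nat) by (intros; rewrite in_seq; lia).
  assert (Hperm : Permutation (map sigma (seq 0 (2 * k))) (seq 0 (2 * k))).
  { apply NoDup_Permutation_bis.
    - apply NoDup_map_NoDup_ForallPairs; [|apply seq_NoDup].
      intros i j Hi Hj. apply Hinj; now apply Hin.
    - now rewrite length_map.
    - intros j Hj. apply in_map_iff in Hj. destruct Hj as [i [<- Hi]]. apply Hin, Hlt. now apply Hin. }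
  rewrite <- (lsum_perm _ _ _ Hperm), lsum_map.
  replace (2 * k)%nat with (k + k)%nat by lia. rewrite seq_app, lsum_app.
  replace (0 + k)%nat with (k + 0)%nat by lia. rewrite seq_map_add, lsum_map.
  transitivity (lsum (seq 0 k) (fun i => 1 * a (sigma i) + 1 * a (sigma (k + i)%nat))).
  - rewrite lsum_lin. ring.
  - apply lsum_zero. intros i Hi. apply in_seq in Hi. rewrite !Rmult_1_l. apply Hpair. lia.
Qed.

Lemma not_invertible_of_symmetric (r : R) (m : nat) (gam : nat -> pt) (c : nat -> R) : 0 < r ->
  (forall i, (i < m)%nat -> unit_vec (gam i)) ->
  symmetric m c gam -> ~ invertible r m c gam.
Proof.
  intros Hr Hunit [k [-> [sigma [Hlt [Hinj Hsym]]]]] Hinv.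
  destruct (exists_line_null gam (seq 0 (2 * k))) with (r := r) as [h [Hh [[p Hp] Hnull]]].
  { intros i Hi. apply in_seq in Hi. apply Hunit. lia. }
  { exact Hr. }
  assert (Hz : C2c r (fun _ => 0)).
  { assert (H0 : (fun _ : pt => 0) = (fun p => h p - h p))
      by (apply functional_extensionality; intros; ring).
    destruct Hh as [Hh [r' [Hr' _]]]. split; [rewrite H0; now apply C2_minus|].
    exists r'. split; [exact Hr' | now intros]. }
  pose proof (nice_C2c _ _ Hh) as Hn.
  assert (Hscal : forall g a x, unit_vec g -> Xray g (fun p => a * h p) x = a * Xray g h x).
  { intros g a x Hg.
    replace (fun p => a * h p) with (fun p => a * h p + 0 * h p)
      by (apply functional_extensionality; intros; ring).
    rewrite (Xray_lin r) by assumption. ring. }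
  (* v stands for the first coordinate of gamma_i or of its perpendicular. Both change sign with the
     direction, and so does the weight, so the coefficients of an opposite pair agree and its beams
     add up to a line integral. *)
  assert (Hsum : forall v : nat -> R,
    (forall i j, gam i = opp_pt (gam j) -> v i = - v j) ->
    forall x, lsum (seq 0 (2 * k)) (fun i => c i * Xray (gam i) (fun p => v i * h p) x) = 0).
  { intros v Hv x. apply (lsum_pairs k sigma _ Hlt Hinj). intros i Hi.
    destruct (Hsym i Hi) as [Hg Hc].
    assert (H1 : (sigma i < 2 * k)%nat) by (apply Hlt; lia).
    assert (H2 : (sigma (k + i) < 2 * k)%nat) by (apply Hlt; lia).
    rewrite !Hscal by now apply Hunit. rewrite (Hv _ _ Hg), Hc, Hg.
    assert (Hl : line_null (gam (sigma (k + i)%nat)) h) by (apply Hnull, in_seq; lia).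
    transitivity (c (sigma (k + i)%nat) * v (sigma (k + i)%nat) *
      (Xray (gam (sigma (k + i)%nat)) h x + Xray (opp_pt (gam (sigma (k + i)%nat))) h x)); [ring|].
    rewrite Hl. ring. }
  assert (Hf : (fun p => (h p, 0)) = (fun _ : pt => (0, 0))).
  { apply Hinv; [now split | now split |].
    apply functional_extensionality. intros x. unfold star.
    assert (Hcomp : forall v : nat -> pt,
      (forall i j, gam i = opp_pt (gam j) -> fst (v i) = - fst (v j)) ->
      sumR (2 * k) (fun i => c i * Xray (gam i) (fun p => dot (h p, 0) (v i)) x) =
      sumR (2 * k) (fun i => c i * Xray (gam i) (fun p => dot (0, 0) (v i)) x)).
    { intros v Hv. transitivity 0.
      - etransitivity; [|exact (Hsum (fun i => fst (v i)) Hv x)]. apply lsum_ext. intros i _. do 2 f_equal.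
        apply functional_extensionality. intros q. unfold dot; simpl. ring.
      - symmetry. apply lsum_zero. intros i Hi. apply in_seq in Hi.
        replace (fun p : pt => dot (0, 0) (v i)) with (fun p => 0 * h p)
          by (apply functional_extensionality; intros q; unfold dot; simpl; ring).
        rewrite Hscal by (apply Hunit; lia). ring. }
    f_equal; apply Hcomp; intros i j ->; unfold perp, opp_pt; simpl; ring. }
  apply Hp. exact (f_equal fst (equal_f Hf p)).
Qed.

Theorem theorem8 (r : R) (m : nat) (gam : nat -> pt) (c : nat -> R) :
  0 < r ->
  (forall i, (i < m)%nat -> unit_vec (gam i)) ->
  (forall i j, (i < m)%nat -> (j < m)%nat -> gam i = gam j -> i = j) ->
  (forall i, (i < m)%nat -> c i <> 0) ->
  (invertible r m c gam <-> ~ symmetric m c gam).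
Proof.
  intros Hr Hunit Hinj Hc. split.
  - intros Hinv Hsym. exact (not_invertible_of_symmetric r m gam c Hr Hunit Hsym Hinv).
  - now apply invertible_of_nonsymmetric.
Qed.
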